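(* For $\alpha\in(0,1/2)$ let $\mathrm{det}_\infty^{f_\alpha}(r)$, $r\in(0,1]$, be the $\infty$-asymptotic determinism (the infinite determinism) of $f_\alpha$ with respect to $\mu_\alpha$, and put $\underline{\mathrm{det}}(\alpha)=\liminf_{r\to0^+}\mathrm{det}_\infty^{f_\alpha}(r)$ and $\overline{\mathrm{det}}(\alpha)=\limsup_{r\to0^+}\mathrm{det}_\infty^{f_\alpha}(r)$. Then: (1) the local minima of the infinite determinism $r\mapsto\mathrm{det}_\infty^{f_\alpha}(r)$ are located at the points $r=\alpha^h-\alpha^{h+2}$, where $h\ge0$ is an integer; (2) $\underline{\mathrm{det}}(\alpha)\in[1/3,8/15]$ for all $\alpha\in(0,1/2)$; (3) $\overline{\mathrm{det}}(\alpha)=1$ for $\alpha\le1/3$, and $\overline{\mathrm{det}}(\alpha)<1$ for $\alpha>1/3$; (4) if $\alpha\le1/3$, then the extremes (the minimal and the maximal value) of $r\mapsto\mathrm{det}_\infty^{f_\alpha}(r)$ on $(0,1]$ are $8/15$ and $1$, and the maxima are achieved at $r=\alpha^h$, $h\ge0$ an integer.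
   Context: For $\alpha\in(0,1/2)$ the continuous map $f_\alpha:[0,1]\to[0,1]$ is defined by: $f_\alpha(x)=x-1+2\alpha^{j-1}-\alpha^j$ for $x\in[1-\alpha^{j-1},1-\alpha^{j-1}+\alpha^j]$, $j\ge1$; $f_\alpha(x)=\frac{1-\alpha+\alpha^2}{2\alpha-1}(x-1)+\alpha^{j+1}\frac{2-\alpha}{2\alpha-1}$ for $x\in(1-\alpha^{j-1}+\alpha^j,1-\alpha^j)$, $j\ge1$; and $f_\alpha(1)=0$. For a word $u=u_1\dots u_k\in\{0,1\}^k$ put $\kappa(u)=(1-\alpha)\sum_{i=1}^k u_i\alpha^{i-1}$ and $I_\alpha(u)=[\kappa(u),\kappa(u)+\alpha^k]$. Let $X_\alpha=\bigcap_{k\ge1}\bigcup_{u\in\{0,1\}^k}I_\alpha(u)$. The measure $\mu_\alpha$ is the unique Borel probability measure on $[0,1]$ with $\mu_\alpha(I_\alpha(u))=2^{-k}$ for all $k\ge1$ and $u\in\{0,1\}^k$; it is $f_\alpha$-ergodic with support $X_\alpha$. For $1\le\ell\le\infty$ put $\varrho_\ell(x,y)=\sup\{|f_\alpha^i(x)-f_\alpha^i(y)| : 0\le i<\ell\}$. The $\ell$-correlation integral is $\mathrm{c}_\ell^{f_\alpha}(r)=\mu_\alpha\times\mu_\alpha\{(x,y):\varrho_\ell(x,y)\le r\}$ for $r>0$, and the $\infty$-asymptotic determinism is $\mathrm{det}_\infty^{f_\alpha}(r)=\mathrm{c}_\infty^{f_\alpha}(r)/\mathrm{c}_1^{f_\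alpha}(r)$.
   Formalization: Item (1) is false if it means all local minima (r=1-α^3 is another strict one); it is proved as: each r=α^h-α^{h+2} is a local minimum and the unique minimizer of the determinism on [α^{h+1},α^h]. *)

(* Defs.v *)
From HB Require Import structures.
From mathcomp Require Import all_boot all_order all_algebra.
From mathcomp Require Import ring lra.
From mathcomp Require Import all_classical all_reals all_analysis.

Set Implicit Arguments.
Unset Strict Implicit.
Unset Printing Implicit Defensive.

Import Order.TTheory GRing.Theory Num.Theory.
Import numFieldNormedType.Exports.

Local Open Scope classical_set_scope.
Local Open Scope ring_scope.

(* The piecewise affine formula for f_alpha, with the index j >= 1 of the
   usual definition shifted to j.+1. *)
Inductive falpha_graph (R : realType) (a : R) : R -> R -> Prop :=
| FalphaShift (j : nat) (x : R) of
    x \in `[1 - a ^+ j, 1 - a ^+ j + a ^+ j.+1] :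
    falpha_graph a x (x - 1 + 2 * a ^+ j - a ^+ j.+1)
| FalphaGap (j : nat) (x : R) of
    x \in `]1 - a ^+ j + a ^+ j.+1, 1 - a ^+ j.+1[ :
    falpha_graph a x ((1 - a + a ^+ 2) / (2 * a - 1) * (x - 1)
                      + a ^+ j.+2 * ((2 - a) / (2 * a - 1)))
| FalphaOne : falpha_graph a 1 0.

(* Only the values on [0, 1] matter; outside [0, 1] the value is 0. The
   lemmas falpha_shift, falpha_gap and falpha1 below recover the formula. *)
Definition falpha (R : realType) (a x : R) : R := xget 0 (falpha_graph a x).

Definition kappa (R : realType) (a : R) (k : nat) (u : k.-tuple bool) : R :=
  (1 - a) * \sum_(i < k) (tnth u i)%:R * a ^+ i.

Definition cylinder (R : realType) (a : R) (k : nat) (u : k.-tuple bool) :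
    set R :=
  `[kappa a u, kappa a u + a ^+ k]%classic.

(* These conditions determine a unique Borel probability measure. *)
Definition is_mu_alpha (R : realType) (a : R)
    (mu : probability (measurableTypeR R) R) : Prop :=
  mu `[0, 1]%classic = 1%E /\
  forall (k : nat) (u : k.-tuple bool), (0 < k)%N ->
    mu (cylinder a u) = ((2 ^- k)%:E)%E.

(* Some l encodes the finite length l, None encodes l = oo. *)
Definition lt_len (i : nat) (l : option nat) : bool :=
  if l is Some n then (i < n)%N else true.

Definition varrho (R : realType) (f : R -> R) (l : option nat) (x y : R) :
    \bar R :=
  ereal_sup [set (`|iter i f x - iter i f y|)%:E | i in [set i | lt_len i l]].

Definition corr_integral (R : realType)
    (mu : probability (measurableTypeR R) R) (f : R -> R) (l : option nat)
    (r : R) : \bar R :=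
  (mu \x mu)%E [set p : measurableTypeR R * measurableTypeR R |
    [/\ p.1 \in `[0, 1], p.2 \in `[0, 1] &
        (varrho f l p.1 p.2 <= r%:E)%E]].

Definition det_infty (R : realType)
    (mu : probability (measurableTypeR R) R) (f : R -> R) (r : R) : R :=
  fine (corr_integral mu f None r) / fine (corr_integral mu f (Some 1%N) r).

Definition det_liminf (R : realType)
    (mu : probability (measurableTypeR R) R) (f : R -> R) : \bar R :=
  limf_einf (fun r : R => (det_infty mu f r)%:E) 0^'+.

Definition det_limsup (R : realType)
    (mu : probability (measurableTypeR R) R) (f : R -> R) : \bar R :=
  limf_esup (fun r : R => (det_infty mu f r)%:E) 0^'+.

Definition local_min_on (R : realType) (D : set R) (g : R -> R) (r : R) :
    Prop :=
  D r /\ \forall s \near r, D s -> g r <= g s.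

Section FalphaSpec.
Variables (R : realType) (a : R).
Hypotheses (a0 : 0 < a) (a2 : a < 2^-1).

Let powS j : 0 < a ^+ j /\ 2 * a ^+ j.+1 < a ^+ j.
Proof.
have b2 : 2 * a < 1 by move: a2; lra.
have p : 0 < a ^+ j by rewrite exprn_gt0.
by split=> //; rewrite exprS mulrA gtr_pMl.
Qed.

Let block_le i j x : 1 - a ^+ j <= x -> x < 1 - a ^+ i.+1 -> (j <= i)%N.
Proof.
move=> jx xi; rewrite leqNgt; apply/negP => ij.
have : a ^+ j <= a ^+ i.+1.
  by apply: ler_wiXn2l => //; [exact: ltW | move: a2; lra].
lra.
Qed.

Let block_eq i j x : 1 - a ^+ i <= x -> x < 1 - a ^+ i.+1 ->
  1 - a ^+ j <= x -> x < 1 - a ^+ j.+1 -> i = j.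
Proof.
move=> ix xi jx xj; apply/eqP.
by rewrite eqn_leq (block_le ix xj) (block_le jx xi).
Qed.

Let shift_block j x : x \in `[1 - a ^+ j, 1 - a ^+ j + a ^+ j.+1] ->
  [/\ 1 - a ^+ j <= x, x <= 1 - a ^+ j + a ^+ j.+1 & x < 1 - a ^+ j.+1].
Proof. by move: (powS j) => [? ?]; rewrite in_itv /= => /andP[? ?]; split=> //; lra. Qed.

Let gap_block j x : x \in `]1 - a ^+ j + a ^+ j.+1, 1 - a ^+ j.+1[ ->
  [/\ 1 - a ^+ j <= x, 1 - a ^+ j + a ^+ j.+1 < x & x < 1 - a ^+ j.+1].
Proof.
have := exprn_gt0 j.+1 a0.
by rewrite in_itv /= => ? /andP[? ?]; split=> //; lra.
Qed.

Lemma falpha_graph_uniq x y z :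
  falpha_graph a x y -> falpha_graph a x z -> y = z.
Proof.
have lt1 j : 1 < 1 - a ^+ j.+1 -> False.
  by have := exprn_gt0 j.+1 a0; lra.
case=> [i {}x /shift_block[ix h xi]|i {}x /gap_block[ix h xi]|] h'.
- inversion h' as [j ? hj|j ? hj|]; subst; last by case: (lt1 i).
    by case/shift_block: hj => jx k xj; rewrite (block_eq ix xi jx xj).
  by case/gap_block: hj => jx k xj; have E := block_eq ix xi jx xj; subst; lra.
- inversion h' as [j ? hj|j ? hj|]; subst; last by case: (lt1 i).
    case/shift_block: hj => jx k xj.
    by have E := block_eq ix xi jx xj; subst; lra.
  by case/gap_block: hj => jx k xj; rewrite (block_eq ix xi jx xj).
- inversion h' as [j ? hj|j ? hj|]; subst => //.
    by case/shift_block: hj => _ _ /lt1.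
  by case/gap_block: hj => _ _ /lt1.
Qed.

Lemma falphaE x y : falpha_graph a x y -> falpha a x = y.
Proof.
move=> h; apply: (falpha_graph_uniq _ h).
by rewrite /falpha; case: xgetP => // /(_ y).
Qed.

Lemma falpha_shift j x : x \in `[1 - a ^+ j, 1 - a ^+ j + a ^+ j.+1] ->
  falpha a x = x - 1 + 2 * a ^+ j - a ^+ j.+1.
Proof. by move=> h; apply: falphaE; constructor. Qed.

Lemma falpha_gap j x : x \in `]1 - a ^+ j + a ^+ j.+1, 1 - a ^+ j.+1[ ->
  falpha a x = (1 - a + a ^+ 2) / (2 * a - 1) * (x - 1)
               + a ^+ j.+2 * ((2 - a) / (2 * a - 1)).
Proof. by move=> h; apply: falphaE; constructor. Qed.

Lemma falpha1 : falpha a 1 = 0.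
Proof. by apply: falphaE; constructor. Qed.

End FalphaSpec.

(* Main.v *)
(* Let T0 x = a x and T1 x = a x + 1 - a. The measure mu is the balanced mixture
   of its images under T0 and T1, and f T0 = T1, f T1 = T0 f on [0, 1]. Hence
   probabilities for mu x mu of events about the f-orbits of two points satisfy
   functional equations obtained by removing one digit from each point.

   Let F be the Cantor distribution function of mu, and Phi that of x - y. The
   one-sided supremum sup_i (f^i x - f^i y) has distribution function F, because
   the latter is the only bounded solution of F (a t) = (F t + F (t - c)) / 2,
   c = (1 - a) / a, that is 0 on t < 0 and 1 on t >= 1. On [a^(h+1), a^h] this
   yields c_oo (a^h (1 - a^2 + a^2 s)) = 2^-(h+1) (1 + F s), while
   c_1 r = 2 Phi r - 1.

   The minimum on [a^(h+1), a^h] is at r_h = a^h - a^(h+2): to the left of r_h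
   the numerator is constant, and to its right the subadditivity of F bounds the
   growth of c_1 by 2 F (r - r_h) = 2^-(h+1) F s. The bounds 1/3 and 8/15 come
   from (15/16) 2^-h <= c_1 r_h <= (3/2) 2^-h; for a <= 1/3 the lower bound is
   an equality and c_1 (a^h) = 2^-h. *)

From HB Require Import structures.
Require Import Defs.
From mathcomp Require Import all_boot all_order all_algebra.
From mathcomp Require Import ring lra.
From mathcomp Require Import all_classical all_reals all_analysis.
From mathcomp Require Import measurable_realfun.

Set Implicit Arguments.
Unset Strict Implicit.
Unset Printing Implicit Defensive.

Import Order.TTheory GRing.Theory Num.Theory.
Import numFieldNormedType.Exports.

Local Open Scope classical_set_scope.
Local Open Scope ring_scope.

(** * Subadditivity of the Cantor function *)

(** Closes the arguments below in which an error term halves with every digit that is removed. *)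
Lemma half_pow_small (R : realType) (x : R) :
  (forall n, x <= 2 ^- n) -> x <= 0.
Proof.
move=> h; apply/ler_addgt0Pr => e e0; rewrite add0r.
have h1 : `|2^-1 : R| < 1 by rewrite gtr0_norm; lra.
have /cvgrPdist_lt /(_ _ e0) [n _ /(_ n (leqnn n))] := cvg_expr h1.
rewrite sub0r normrN ger0_norm ?exprn_ge0// exprVn => /ltW.
exact: le_trans (h n).
Qed.

Section Digits.
Variables (R : realType) (a c : R).
Hypotheses (a0 : 0 < a) (a2 : a < 2^-1) (ac : a * c = 1 - a).

(** Since T1 x = a (x + c), this says that the images of [0, 1] under T0 and T1 are disjoint. *)
Lemma ac_gt1 : 1 < c.
Proof. by rewrite -(ltr_pM2l a0) ac; move: a2; lra. Qed.

(** Two leading digits 1 contribute 2 (1 - a) to a sum; this inequality lets the carry [c] absorb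
    them. *)
Lemma ac_gt2 : 2 * (1 - a) < c.
Proof.
have c1 := ac_gt1; have : (1 - 2 * a) * c > 0 by apply: mulr_gt0; move: a2; lra.
by move: ac; lra.
Qed.

Section CantorFunction.
Variable F : R -> R.
Hypotheses (Fm : {homo F : x y / x <= y})
  (F0 : forall x : R, x < 0 -> F x = 0) (F1 : forall x : R, 1 <= x -> F x = 1)
  (FE : forall x, F (a * x) = 2^-1 * (F x + F (x - c))).

Lemma cantor_ge0 (x : R) : 0 <= F x.
Proof.
have [x0|x0] := ltP x 0; first by rewrite F0.
by rewrite -(@F0 (-1)) ?Fm//; lra.
Qed.

Lemma cantor_le1 (x : R) : F x <= 1.
Proof. by have [/F1->//|x1] := leP 1 x; rewrite -(@F1 1)// Fm// ltW. Qed.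

Lemma cantor_left (x : R) : x <= 1 -> F (a * x) = 2^-1 * F x.
Proof. by have c1 := ac_gt1 => x1; rewrite FE (@F0 (x - c)) ?addr0//; lra. Qed.

Lemma cantor_right (x : R) : 0 <= x -> F (1 - a + a * x) = 2^-1 * (1 + F x).
Proof.
have c1 := ac_gt1 => x0; rewrite -ac -mulrDr FE addrC.
by rewrite [c + x]addrC addrK (@F1 (x + c)) 1?addrC//; lra.
Qed.

Lemma cantor_scale n (x : R) : x <= 1 -> F (a ^+ n * x) = 2 ^- n * F x.
Proof.
move=> x1; elim: n => [|n IH]; first by rewrite !expr0 invr1 !mul1r.
rewrite exprS -mulrA cantor_left.
  by rewrite IH mulrA -invfM -exprS.
have an : a ^+ n <= 1 by apply: exprn_ile1; move: a0 a2; lra.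
have := exprn_gt0 n a0; nra.
Qed.

Lemma exp_small (x : R) : 0 < x -> exists n, a ^+ n < x.
Proof.
move=> x0; have a1 : `|a| < 1 by rewrite gtr0_norm//; move: a2; lra.
have /cvgrPdist_lt /(_ _ x0) [n _ /(_ n (leqnn n))] := cvg_expr a1.
rewrite sub0r normrN ger0_norm; first by exists n.
by rewrite exprn_ge0// ltW.
Qed.

Lemma cantor_gt0 (x : R) : 0 < x -> 0 < F x.
Proof.
move=> x0; have [n nx] := exp_small x0.
apply: lt_le_trans (Fm (ltW nx)).
by rewrite -(mulr1 (a ^+ n)) cantor_scale// F1// mulr1 invr_gt0 exprn_gt0.
Qed.

(* A point of a gap may be moved up to the right end of the gap. *)
Lemma cantor_digit (t : R) : 0 <= t <= 1 -> exists x, 0 <= x <= 1 /\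
  (t <= a * x /\ F t = 2^-1 * F x \/
   t <= 1 - a + a * x /\ F t = 2^-1 * (1 + F x)).
Proof.
move=> /andP[t0 t1]; have [ta|ta] := leP t a.
  have tx : t = a * (t / a) by rewrite mulrC divfK// gt_eqF.
  exists (t / a); split; first by rewrite divr_ge0 ?ler_pdivrMr// ?mul1r// ltW.
  by left; split; [rewrite -tx|rewrite {1}tx cantor_left// ler_pdivrMr// mul1r].
have [ta1|ta1] := leP (1 - a) t.
  have tx : t = 1 - a + a * ((t - 1 + a) / a).
    by rewrite mulrC divfK ?gt_eqF//; lra.
  have x0 : 0 <= (t - 1 + a) / a by apply: divr_ge0; [lra|exact: ltW].
  exists ((t - 1 + a) / a); split.
    by rewrite x0 ler_pdivrMr// mul1r; lra.
  by right; split; [rewrite -tx|rewrite {1}tx cantor_right].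
have h0 : F 0 = 0.
  by have := @cantor_left 0 ler01; rewrite mulr0; lra.
exists 0; split; first by rewrite lexx ler01.
right; split; first by rewrite mulr0 addr0 ltW.
apply/eqP; rewrite eq_le; apply/andP; split.
  by rewrite -cantor_right// mulr0 addr0; apply: Fm; exact: ltW.
have := Fm (ltW ta); have := @cantor_left 1 (lexx 1).
by rewrite h0 mulr1 (@F1 1)//; lra.
Qed.

(* The error term makes this inequality, which is self-improving under the
   functional equation, accessible to induction; the three cases are those of
   the leading digits, where 11 produces a carry. *)
Lemma cantor_subadd_approx n (s t : R) : 0 <= s <= 1 -> 0 <= t <= 1 ->
  F (s + t) + F (s + t - c) <= F s + F t + 2 * 2 ^- n.
Proof.
have c1 := ac_gt1; have c2 := ac_gt2.
elim: n s t => [|n IH] s t /[dup] s01 /cantor_digit[x [x01 hx]]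
  /[dup] t01 /cantor_digit[y [y01 hy]].
  rewrite expr0 invr1.
  have := cantor_le1 (s + t); have := cantor_le1 (s + t - c).
  have := cantor_ge0 s; have := cantor_ge0 t; lra.
have := IH _ _ x01 y01; rewrite exprS invfM.
move: (2 ^- n) => e {}IH.
have zE := FE (x + y); set z := x + y in IH zE.
have z0 : 0 <= z <= 2 by rewrite /z; lra.
have az : a * z < c.
  have : a * z <= a * 2 by rewrite ler_pM2l//; lra.
  by move: a2; lra.
have Fle u v w : u <= v -> F v <= w -> F u <= w.
  by move=> uv; apply: le_trans; exact: Fm.
have R0 : F (1 - a + a * z) = 2^-1 * (1 + F z) by rewrite cantor_right//; lra.
case: hx hy => -[hs ->] [] [ht ->].
- have h1 : F (s + t) <= F (a * z) by apply: Fm; rewrite /z mulrDr; lra.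
  have h2 : F (s + t - c) = 0.
    by apply: F0; move: hs ht az; rewrite /z mulrDr; lra.
  lra.
- have h1 : F (s + t) <= F (1 - a + a * z) by apply: Fm; rewrite /z mulrDr; lra.
  (* Here 2 (1 - a) < c is used in the form (1 - a) - c <= - a c. *)
  have h2 : F (s + t - c) <= F (a * (z - c)).
    by apply: Fm; rewrite mulrBr ac /z mulrDr; lra.
  have h3 := FE (z - c); rewrite (@F0 (z - c - c)) in h3; lra.
- have h1 : F (s + t) <= F (1 - a + a * z) by apply: Fm; rewrite /z mulrDr; lra.
  have h2 : F (s + t - c) <= F (a * (z - c)).
    by apply: Fm; rewrite mulrBr ac /z mulrDr; lra.
  have h3 := FE (z - c); rewrite (@F0 (z - c - c)) in h3; lra.
- have h1 := cantor_le1 (s + t).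
  have h2 : F (s + t - c) <= F (a * z) by apply: Fm; rewrite /z mulrDr; lra.
  lra.
Qed.

(** On the unit interval the nonnegative term [F (s + t - c)] is dropped and the error of
    [cantor_subadd_approx] sent to 0; elsewhere one of the values of [F] is 0 or 1. *)
Lemma cantor_subadd (t l : R) : 0 <= l -> F (t + l) - F t <= F l.
Proof.
move=> l0; have c1 := ac_gt1.
have base u v : 0 <= u <= 1 -> 0 <= v <= 1 -> F (u + v) <= F u + F v.
  (* The division by 2 absorbs the factor 2 of the error term. *)
  move=> u01 v01; suff : (F (u + v) - F u - F v) / 2 <= 0 by lra.
  apply: half_pow_small => n.
  have := cantor_subadd_approx n u01 v01.
  have := cantor_ge0 (u + v - c); lra.
have [t0|t0] := ltP t 0.
  by rewrite (@F0 t)// subr0 Fm//; lra.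
have [t1|t1] := leP 1 t.
  by rewrite (@F1 t)// (@F1 (t + l)) ?subrr ?cantor_ge0//; lra.
have [l1|l1] := leP 1 l.
  rewrite (@F1 l)//; have := cantor_le1 (t + l); have := cantor_ge0 t; lra.
have := @base t l; lra.
Qed.

End CantorFunction.

End Digits.

(** * Quotients of self-similar correlation functions *)

Section ScalarDeterminism.
Variables (R : realType) (a c : R).
Hypotheses (a0 : 0 < a) (a2 : a < 2^-1) (ac : a * c = 1 - a).
Variables F Phi L : R -> R.
(* Phi is the distribution function of x - y for mu x mu, so that C is the
   1-correlation integral; L is the oo-correlation integral, and the minima
   are at a ^+ h * rho. *)
Hypotheses (Fm : {homo F : x y / x <= y})
  (F0 : forall x : R, x < 0 -> F x = 0) (F1 : forall x : R, 1 <= x -> F x = 1)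
  (FE : forall x, F (a * x) = 2^-1 * (F x + F (x - c))).
Hypotheses (Pm : {homo Phi : x y / x <= y})
  (P1 : forall x : R, 1 <= x ->
    Phi x = 1) (PN : forall x, Phi (- x) = 1 - Phi x)
  (PE : forall x, Phi (a * x) =
    4^-1 * Phi (x + c) + 2^-1 * Phi x + 4^-1 * Phi (x - c))
  (PF : forall t l : R, 0 <= l -> Phi (t + l) - Phi t <= F l)
  (FP : forall t, F t <= Phi t).
Hypotheses (L1 : forall x : R, 1 <= x -> L x = 1)
  (LE : forall x, L (a * x) = 2^-1 * (L x + F ((x - c) / a - c))).

Let C r := 2 * Phi r - 1.
Let rho := 1 - a ^+ 2.
Let c_gt1 := ac_gt1 a0 a2 ac.
Let c_gt2 := ac_gt2 a0 a2 ac.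

(** * Values and scaling of [Phi] and of the 1-correlation integral [C] *)

Lemma phi0 : Phi 0 = 2^-1.
Proof. by have := PN 0; rewrite oppr0; lra. Qed.

Lemma phi_le1 (x : R) : Phi x <= 1.
Proof. by have [/P1->//|x1] := leP 1 x; rewrite -(@P1 1)// Pm// ltW. Qed.

Lemma phi_ge0 (x : R) : 0 <= Phi x.
Proof. by have := phi_le1 (- x); rewrite PN; lra. Qed.

Lemma phi_right (x : R) : 1 - c <= x ->
  Phi (1 - a + a * x) = 4^-1 * (3 + Phi x).
Proof.
have c1 := c_gt1; move=> xc; rewrite -ac -mulrDr PE addrC.
rewrite [c + x]addrC addrK.
by rewrite (@P1 (x + c)) ?(@P1 (x + c + c)); lra.
Qed.

Lemma phi_1a : Phi (1 - a) = 7 / 8.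
Proof.
have c1 := c_gt1; have := @phi_right 0; rewrite mulr0 addr0 phi0; lra.
Qed.

Lemma corr_scale (x : R) :
  C (a * x) = 2^-1 * (C x + (Phi (x + c) + Phi (x - c) - 1)).
Proof. by rewrite /C PE; lra. Qed.

(** Pairs with equal leading digits already give [2^-1 * C x]; pairs with different ones add half of
    [Phi (x + c) - Phi (c - x)], which is nonnegative. *)
Lemma corr_half (x : R) : 0 <= x -> 2^-1 * C x <= C (a * x).
Proof.
move=> x0; have := PN (x - c); rewrite opprB corr_scale.
have : Phi (c - x) <= Phi (x + c) by apply: Pm; lra.
by lra.
Qed.

Lemma corr_pow n (x : R) : 0 <= x -> 2 ^- n * C x <= C (a ^+ n * x).
Proof.
move=> x0; elim: n => [|n IH].
  by rewrite !expr0 invr1 !mul1r.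
rewrite !exprS -mulrA invfM -mulrA.
apply: le_trans (corr_half _); last by rewrite mulr_ge0// exprn_ge0// ltW.
by rewrite ler_pM2l// invr_gt0.
Qed.

Lemma corr_top (x : R) : 1 <= x -> C (a * x) = 2^-1 * (1 + Phi (x - c)).
Proof.
by have c1 := c_gt1 => x1; rewrite corr_scale /C (@P1 x)// (@P1 (x + c)); lra.
Qed.

Let rhoE : rho = a * (c + (1 - a)).
Proof. by rewrite mulrDr ac /rho; ring. Qed.

(** As rho = a (c + (1 - a)), removing one digit leads to 1 - a and removing another leads to 0,
    where symmetry gives 1/2. Backwards the values are 1/2, 7/8, 15/16. *)
Lemma corr_rho : C rho = 15 / 16.
Proof.
have c1 := c_gt1; rewrite rhoE corr_top; last by move: a2; lra.
by rewrite [c + _]addrC addrK phi_1a; lra.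
Qed.

(* Distinct blocks of the same level only interact near their facing ends: this
   bounds the mass of the pairs whose difference is close to c. *)
Lemma phi_window n (x : R) : c <= x ->
  Phi (x + a ^+ n * rho) - Phi (x - a ^+ n * rho) <= 4 ^- n * (9 / 32).
Proof.
have c1 := c_gt1; have c2 := c_gt2.
have aa : 0 < a ^+ 2 < 1.
  by rewrite exprn_gt0//= exprn_ilt1 ?ltW//; move: a0 a2; lra.
elim: n x => [|n IH] x xc.
  rewrite expr0 invr1 !mul1r; have := phi_le1 (x + rho).
  (* 23/32 = 1/4 + (1/2)(7/8) + (1/4)(1/8): the functional equation at c - rho = a y, with y >= 1 -
     a and y - c >= - (1 - a). *)
  suff : 23 / 32 <= Phi (x - rho) by lra.
  apply: (@le_trans _ _ (Phi (c - rho))); last by apply: Pm; lra.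
  have [y ty] : exists y, c - rho = a * y.
    by exists ((c - rho) / a); rewrite mulrC divfK// gt_eqF.
  have y1 : 1 - a <= y.
    rewrite -(ler_pM2l a0) -ty /rho.
    have : a * (c - 1 + a ^+ 2 - (a * (1 - a))) = (1 - 2 * a) * (1 - a ^+ 2).
      by rewrite !(mulrBr, mulrDr) ac; ring.
    have : 0 < (1 - 2 * a) * (1 - a ^+ 2) by apply: mulr_gt0; move: a2; lra.
    by move=> /[swap] <-; rewrite pmulr_rgt0//; lra.
  have y2 : - (1 - a) <= y - c.
    suff : c - 1 + a <= y by lra.
    rewrite -(ler_pM2l a0) -ty mulrDr mulrBr ac /rho.
    have : a * a = a ^+ 2 by rewrite expr2.
    by lra.
  rewrite ty PE (@P1 (y + c)); last by move: a2; lra.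
  have := Pm y1; have := Pm y2; rewrite PN phi_1a; lra.
have xE : x = a * (x / a) by rewrite mulrC divfK// gt_eqF.
(* With x / a >= 2 c and a radius at most 1, the terms of [PE] around x / a + c and x / a equal 1
   and cancel; only the term of weight 1/4 around x / a - c >= c remains. *)
have y2c : 2 * c <= x / a.
  by rewrite ler_pdivlMr// -mulrA [c * a]mulrC ac; move: a2; lra.
have b : 0 < a ^+ n * rho <= 1.
  rewrite mulr_gt0 ?exprn_gt0 ?/rho//=; last lra.
  rewrite mulr_ile1 ?exprn_ge0 ?exprn_ile1//; move: a0 a2; lra.
have := IH (x / a - c).
move: y2c xE; set y := x / a => y2c {1 2}->.
rewrite !exprS -mulrA -mulrDr -mulrBr !PE invfM.
move: (4 ^- n) (a ^+ n * rho) b => e d d01 {}IH.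
rewrite (@P1 (y + d + c)) ?(@P1 (y - d + c)) ?(@P1 (y + d)) ?(@P1 (y - d));
  try lra.
rewrite (addrAC y d) (addrAC y (- d)).
by have := IH; lra.
Qed.

Lemma corr_pow_rho_le n : C (a ^+ n * rho) <= 2 ^- n * (3 / 2).
Proof.
(* The strengthened bound is 15/16 at n = 0 and closes the induction: each step adds the window mass
   4^-n (9/32) around c, and these contributions sum geometrically. *)
suff : C (a ^+ n * rho) <= 2 ^- n * (3 / 2 - 2 ^- n * (9 / 16)).
  move/le_trans; apply; rewrite ler_pM2l ?invr_gt0 ?exprn_gt0//.
  have : 0 <= 2 ^- n :> R by rewrite invr_ge0 exprn_ge0.
  by lra.
elim: n => [|n IH]; first by rewrite !expr0 invr1 !mul1r corr_rho; lra.
rewrite !exprS -mulrA corr_scale.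
have := PN (a ^+ n * rho - c); rewrite opprB => hN.
have := phi_window n (lexx c); rewrite [c + _]addrC hN.
have -> : 4 ^- n = 2 ^- n * 2 ^- n :> R.
  by rewrite -invfM -exprMn; congr (_ ^+ _)^-1; lra.
move: IH; rewrite invfM.
by move: (2 ^- n) => e; lra.
Qed.

(** All terms of [PE] are monotone and have positive weight, so strict growth of one suffices.
    Strict growth is needed for a strict minimum, since the numerator is constant to the left of
    it. *)
Lemma phi_strict_scale (u v : R) : u <= v -> Phi u < Phi v ->
  Phi (a * u) < Phi (a * v).
Proof.
move=> uv h; rewrite !PE.
have h1 : Phi (u + c) <= Phi (v + c) by apply: Pm; lra.
have h2 : Phi (u - c) <= Phi (v - c) by apply: Pm; lra.
lra.
Qed.

Lemma phi_strict_right (u v : R) : u <= v -> Phi u < Phi v ->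
  Phi (1 - a + a * u) < Phi (1 - a + a * v).
Proof.
move=> uv h; rewrite -ac -!mulrDr !PE.
rewrite [c + u]addrC [c + v]addrC !addrK.
have h1 : Phi (u + c + c) <= Phi (v + c + c) by apply: Pm; lra.
have h2 : Phi (u + c) <= Phi (v + c) by apply: Pm; lra.
lra.
Qed.

Lemma phi_strict_pow n (u v : R) : u <= v -> Phi u < Phi v ->
  Phi (a ^+ n * u) < Phi (a ^+ n * v).
Proof.
move=> uv h; elim: n => [|n IH]; first by rewrite expr0 !mul1r.
rewrite exprS -!mulrA; apply: phi_strict_scale => //.
by rewrite ler_pM2l// exprn_gt0.
Qed.

Lemma phi_lt0 (x : R) : x < 0 -> Phi x < Phi 0.
Proof.
move=> x0; have [|n nx] := exp_small a0 a2 (x := - x).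
  by rewrite oppr_gt0.
have := @phi_strict_pow n (-1) 0; rewrite mulr0 mulrN1 => /(_ (lerN10 _)).
have -> : Phi (-1) = 0 by rewrite PN P1 ?subrr.
rewrite phi0; move=> /(_ ltac:(lra)); apply: le_lt_trans.
by apply: Pm; lra.
Qed.

(** Strict growth to the left of 0 is carried to rho = T1 (T1 0) by applying [phi_strict_right]
    twice. *)
Lemma phi_lt_rho (x : R) : x < rho -> Phi x < Phi rho.
Proof.
move=> xr.
have aa : 0 < a ^+ 2 by rewrite exprn_gt0.
have d0 : (x - rho) / a ^+ 2 < 0 by rewrite ltr_pdivrMr// mul0r; lra.
have h := phi_strict_right (ltW d0) (phi_lt0 d0).
have le1 : 1 - a + a * ((x - rho) / a ^+ 2) <= 1 - a + a * 0.
  by rewrite lerD2l ler_pM2l// ltW.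
have := phi_strict_right le1 h.
have -> : 1 - a + a * (1 - a + a * 0) = rho by rewrite /rho; ring.
suff -> : 1 - a + a * (1 - a + a * ((x - rho) / a ^+ 2)) = x by [].
by rewrite /rho; field; rewrite gt_eqF.
Qed.

(** The points -1 + a^n decrease to -1, and the value of [Phi] at each is at least a quarter of the
    preceding one, starting with 1/2 at 0. *)
Lemma phi_gt0 (x : R) : -1 < x -> 0 < Phi x.
Proof.
move=> x1; have [|n nx] := exp_small a0 a2 (x := x + 1); first lra.
apply: (@lt_le_trans _ _ (Phi (-1 + a ^+ n * 1))); last by apply: Pm; lra.
elim: n {nx} => [|n IH]; first by rewrite expr0 mul1r addNr phi0; lra.
have -> : -1 + a ^+ n.+1 * 1 = a * ((-1 + a ^+ n * 1) - c).
  by rewrite mulrBr ac exprS; ring.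
rewrite PE subrK.
by have := phi_ge0 (-1 + a ^+ n * 1 - c); have :=
  phi_ge0 (-1 + a ^+ n * 1 - c - c); lra.
Qed.

(** * The oo-correlation integral [L] and its quotient by [C] *)

Lemma det_corr_scale (x : R) : x <= 1 -> L (a * x) = 2^-1 * L x.
Proof.
have c1 := c_gt1; move=> x1; rewrite LE (@F0 (_ - c)) ?addr0//.
rewrite subr_lt0 ltr_pdivrMr// mulrC ac; move: a2; lra.
Qed.

Lemma det_corr_pow n (x : R) : x <= 1 -> L (a ^+ n * x) = 2 ^- n * L x.
Proof.
move=> x1; elim: n => [|n IH].
  by rewrite !expr0 invr1 !mul1r.
rewrite exprS -mulrA det_corr_scale; first by rewrite IH mulrA -invfM -exprS.
have an : a ^+ n <= 1 by apply: exprn_ile1; move: a0 a2; lra.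
have := exprn_gt0 n a0; nra.
Qed.

(** The coordinate that rescales the second-level cylinder [rho, 1] to [0, 1]; it is negative to the
    left of [rho]. *)
Let ss x := (x - rho) / a ^+ 2.
Let ssE x : rho + a ^+ 2 * ss x = x.
Proof. by rewrite /ss mulrC divfK ?gt_eqF ?exprn_gt0//; ring. Qed.

Lemma det_corr_top (x : R) : a <= x ->
  L x = 2^-1 * (1 + F ((x - rho) / a ^+ 2)).
Proof.
move=> ax.
have xE : x = a * (x / a) by rewrite mulrC divfK// gt_eqF.
rewrite {1}xE LE L1 ?ler_pdivlMr ?mul1r//; congr (_ * (_ + F _)).
have -> : c = (1 - a) / a by rewrite -ac mulrC mulKf// gt_eqF.
by rewrite /rho; field; rewrite gt_eqF.
Qed.

Lemma corr_top_ss (x : R) : a <= x ->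
  C x = 2^-1 * (1 + Phi (1 - a + a * ss x)).
Proof.
move=> ax.
have xE : x = a * (x / a) by rewrite mulrC divfK// gt_eqF.
rewrite {1}xE corr_top ?ler_pdivlMr ?mul1r//; congr (_ * (_ + Phi _)).
have -> : c = (1 - a) / a by rewrite -ac mulrC mulKf// gt_eqF.
by rewrite /ss /rho; field; rewrite gt_eqF.
Qed.


Lemma corr_ge_half n (x : R) : a <= x -> 2 ^- n * 2^-1 <= C (a ^+ n * x).
Proof.
move=> ax; have x0 : 0 <= x by apply: le_trans ax; exact: ltW.
apply: le_trans (corr_pow n x0).
rewrite ler_pM2l ?invr_gt0 ?exprn_gt0// corr_top_ss//.
by have := phi_ge0 (1 - a + a * ss x); lra.
Qed.

Lemma corr_gt0 n (x : R) : a <= x -> 0 < C (a ^+ n * x).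
Proof.
move=> /(corr_ge_half n); apply: lt_le_trans.
by rewrite mulr_gt0 ?invr_gt0 ?exprn_gt0.
Qed.

Lemma ss_le1 (x : R) : x <= 1 -> ss x <= 1.
Proof. by move=> x1; rewrite /ss ler_pdivrMr ?exprn_gt0// /rho; lra. Qed.

(** Both sides have the form (1 + .) / 2, and F s <= Phi s <= Phi (1 - a + a s) because s <= 1. *)
Lemma det_corr_le_corr (x : R) : a <= x <= 1 -> L x <= C x.
Proof.
move=> /andP[ax x1]; rewrite det_corr_top// corr_top_ss//.
rewrite ler_pM2l ?invr_gt0// lerD2l (le_trans (FP _))// Pm//.
rewrite -/(ss x); have := ss_le1 x1; move: (ss x) a2 => s a21 s1.
have : 0 <= (1 - a) * (1 - s) by apply: mulr_ge0; lra.
lra.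
Qed.

Lemma a_le_rho : a <= rho.
Proof.
have : a * a <= 2^-1 * a by rewrite ler_pM2r// ltW.
by rewrite /rho expr2; move: a0 a2; lra.
Qed.

Lemma rho_lt1 : rho < 1.
Proof. by rewrite /rho; have := exprn_gt0 2 a0; lra. Qed.

Lemma cantor0 : F 0 = 0.
Proof.
by have := FE 0; rewrite mulr0 (@F0 (0 - c)); have := c_gt1; lra.
Qed.

Lemma det_corr_rho n : L (a ^+ n * rho) = 2 ^- n * 2^-1.
Proof.
rewrite det_corr_pow ?(ltW rho_lt1)// det_corr_top ?a_le_rho//.
by rewrite subrr mul0r cantor0 addr0 mulr1.
Qed.

Let D r := L r / C r.

Lemma det_le1 n (x : R) : a <= x <= 1 -> D (a ^+ n * x) <= 1.
Proof.
move=> /[dup] ax1 /andP[ax x1]; rewrite /D ler_pdivrMr ?corr_gt0// mul1r.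
have x0 : 0 <= x by apply: le_trans ax; exact: ltW.
apply: le_trans (corr_pow n x0); rewrite det_corr_pow//.
by rewrite ler_pM2l ?invr_gt0 ?exprn_gt0// det_corr_le_corr.
Qed.

Lemma corr_rho_ge n : 2 ^- n * (15 / 16) <= C (a ^+ n * rho).
Proof.
by rewrite -corr_rho corr_pow// (le_trans _ a_le_rho)// ltW.
Qed.

Lemma det_min n (x : R) : a <= x <= 1 -> x != rho ->
  D (a ^+ n * rho) < D (a ^+ n * x).
Proof.
move=> /andP[ax x1]; rewrite /D neq_lt det_corr_rho => /orP[xr|rx].
  rewrite det_corr_pow// det_corr_top// (@F0 (_ / _)); last first.
    by rewrite ltr_pdivrMr ?exprn_gt0// mul0r subr_lt0.
  rewrite addr0 mulr1 ltr_pM2l ?mulr_gt0 ?invr_gt0 ?exprn_gt0//.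
  rewrite ltf_pV2 ?posrE ?corr_gt0 ?a_le_rho// /C.
  by have := phi_strict_pow n (ltW xr) (phi_lt_rho xr); lra.
rewrite det_corr_pow// det_corr_top// -/(ss x).
rewrite ltr_pdivrMr ?corr_gt0 ?a_le_rho// mulrAC ltr_pdivlMr ?corr_gt0//.
have s0 : 0 < ss x by rewrite divr_gt0 ?exprn_gt0// subr_gt0.
have s1 := ss_le1 x1.
have Fs := cantor_gt0 a0 a2 ac Fm F0 F1 FE s0.
have Fsn := cantor_scale a0 a2 ac F0 FE n.+2 s1.
have d0 : 0 <= a ^+ n.+2 * ss x by rewrite mulr_ge0 ?exprn_ge0 ?ltW.
have := PF (a ^+ n * rho) d0; rewrite Fsn.
have -> : a ^+ n * rho + a ^+ n.+2 * ss x = a ^+ n * x.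
  by rewrite -addn2 exprD -mulrA -mulrDr ssE.
have := corr_rho_ge n; have := exprn_gt0 n (ltr0n R 2).
have -> : 2 ^- n.+2 = 2 ^- n * 4^-1 :> R.
  by rewrite -invfM -[4]/((2 * 2)%N%:R) natrM -expr2 -exprD addn2.
rewrite -invr_gt0 /C.
move: (2 ^- n) (F (ss x)) Fs => e f f0 e0 h1 h2.
rewrite -!mulrA ltr_pM2l// ltr_pM2l//.
move: h1 h2; move: (Phi (a ^+ n * rho)) (Phi (a ^+ n * x)) => p q h1 h2.
(* The growth of [C] is at most e f / 2, whereas the relative growth f of [L] leaves room for f
   C(r_h) >= (15/16) e f, which is larger. *)
have : 0 < e * f by rewrite mulr_gt0.
have : e * f * (15 / 16) <= (2 * p - 1) * f.
  by rewrite mulrAC ler_pM2r.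
lra.
Qed.

Lemma det_rho_ge n : 3^-1 <= D (a ^+ n * rho).
Proof.
rewrite /D det_corr_rho ler_pdivlMr ?corr_gt0 ?a_le_rho//.
by have := corr_pow_rho_le n; lra.
Qed.

Lemma det_rho_le n : D (a ^+ n * rho) <= 8 / 15.
Proof.
rewrite /D det_corr_rho ler_pdivrMr ?corr_gt0 ?a_le_rho//.
by have := corr_rho_ge n; lra.
Qed.

Lemma det_rho0 : D rho = 8 / 15.
Proof.
by have := det_corr_rho 0; rewrite /D corr_rho expr0 invr1 !mul1r => ->; lra.
Qed.

(** For a <= 1/3 one has c >= 2, so pairs with different leading digits almost surely do not
    contribute, and the inequality of [corr_half] becomes an equality. *)
Lemma corr_pow_small n (x : R) : a <= 3^-1 -> 0 <= x <= 1 ->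
  C (a ^+ n * x) = 2 ^- n * C x.
Proof.
move=> a3 /andP[x0 x1].
have c3 : 2 <= c by rewrite -(ler_pM2l a0) ac; move: a3; lra.
elim: n => [|n IH].
  by rewrite !expr0 invr1 !mul1r.
rewrite !exprS -mulrA corr_scale IH.
have : 0 <= a ^+ n * x <= 1.
  rewrite mulr_ge0 ?exprn_ge0 ?(ltW a0)//=.
  by rewrite mulr_ile1 ?exprn_ge0 ?exprn_ile1 ?(ltW a0)//; move: a2; lra.
move: (a ^+ n * x) => y y01.
have := PN (y - c); rewrite opprB (@P1 (c - y)) ?(@P1 (y + c)); [|lra..].
by rewrite invfM; lra.
Qed.

Lemma det_pow_small n : a <= 3^-1 -> D (a ^+ n) = 1.
Proof.
move=> a3; rewrite /D -[a ^+ n]mulr1 corr_pow_small ?ler01 ?lexx//.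
rewrite det_corr_pow// L1// /C P1// [2 * 1 - 1](_ : _ = 1); last by ring.
by rewrite divff// mulr1 invr_neq0// expf_neq0// pnatr_eq0.
Qed.

Lemma det_rho_small n : a <= 3^-1 -> D (a ^+ n * rho) = 8 / 15.
Proof.
move=> a3; rewrite -det_rho0 /D corr_pow_small//; last first.
  by rewrite (ltW rho_lt1) (le_trans _ a_le_rho)// ltW.
by rewrite det_corr_pow ?(ltW rho_lt1)// invfM mulrACA divff ?mul1r.
Qed.

(** For a > 1/3 one has c < 2, and the gap is bounded below in three ranges, one for each term of
    the minimum. For x >= c / 2, pairs with different leading digits contribute [Phi (- (c / 2))] or
    more. For smaller x < rho, [L] has no [F] term while [C] has a positive one. Otherwise (3 + Phi
    s) / 4 exceeds F s by at least 3/4 of 1 - F s, and s stays below its value at c / 2. *)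
Lemma corr_gap : 3^-1 < a -> exists2 e : R, 0 < e &
  forall x, a <= x <= 1 -> L (a * x) + e <= C (a * x).
Proof.
move=> a3; have c1 := c_gt1.
have c3 : c < 2 by rewrite -(ltr_pM2l a0) ac; move: a3; lra.
have q1 : 0 < Phi (- (c / 2)) by apply: phi_gt0; lra.
have q2 : 0 < Phi (1 - c) by apply: phi_gt0; lra.
have q3 : F (ss (c / 2)) < 1.
  have aa := exprn_gt0 2 a0.
  have s1 : ss (c / 2) < 1 by rewrite /ss ltr_pdivrMr// /rho; lra.
  have := FP (ss (c / 2)); have := PN (- ss (c / 2)); rewrite opprK.
  by have := phi_gt0 (x := - ss (c / 2)); lra.
pose e1 := Num.min (2^-1 * Phi (- (c / 2))) (4^-1 * Phi (1 - c)).
exists (Num.min e1 (3 / 16 * (1 - F (ss (c / 2))))).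
  by rewrite !lt_min; apply/andP; split; [apply/andP; split|]; lra.
move=> x /andP[ax x1].
have le1 : Num.min e1 (3 / 16 * (1 - F (ss (c / 2)))) <= 2^-1 * Phi (- (c / 2)).
  by rewrite !ge_min lexx.
have le2 : Num.min e1 (3 / 16 * (1 - F (ss (c / 2)))) <= 4^-1 * Phi (1 - c).
  by rewrite !ge_min lexx orbT.
have le3 : Num.min e1 (3 / 16 * (1 - F (ss (c / 2)))) <=
    3 / 16 * (1 - F (ss (c / 2))) by rewrite !ge_min lexx !orbT.
move: (Num.min _ _) le1 le2 le3 => e le1 le2 le3.
have x0 : 0 < x by apply: lt_le_trans ax.
rewrite corr_scale (@P1 (x + c)); last lra.
rewrite det_corr_scale// det_corr_top// corr_top_ss// -/(ss x).
have h1 : F (ss x) <= Phi (1 - a + a * ss x).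
  have := @det_corr_le_corr x; rewrite ax x1 det_corr_top// corr_top_ss//.
  by rewrite -/(ss x); lra.
have [xc|xc] := leP (c / 2) x.
  have : Phi (- (c / 2)) <= Phi (x - c) by apply: Pm; lra.
  lra.
have := phi_ge0 (x - c).
have [s0|s0] := ltP (ss x) 0.
  rewrite (F0 s0).
  suff : Phi (1 - c) <= Phi (1 - a + a * ss x) by lra.
  (* After multiplication by a the inequality reads a <= x. *)
  apply: Pm; rewrite -(ler_pM2l a0) mulrBr ac mulr1 mulrDr mulrA -expr2.
  have := ssE x; rewrite /rho (_ : a * (1 - a) = a - a ^+ 2); last by ring.
  lra.
rewrite phi_right; last lra.
have : F (ss x) <= F (ss (c / 2)).
  by apply: Fm; rewrite /ss ler_pM2r ?invr_gt0 ?exprn_gt0//; lra.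
have := FP (ss x); lra.
Qed.

(** As [L] is at most 1, the additive gap e yields the factor 1 + e, which [corr_pow] carries to all
    smaller scales. One factor a is reserved because [corr_gap] concerns a x. *)
Lemma det_bound_large : 3^-1 < a -> exists2 d : R, d < 1 &
  forall n x, a <= x <= 1 -> D (a ^+ n.+1 * x) <= d.
Proof.
move=> /corr_gap[e e0 he]; exists (1 + e)^-1; first by rewrite invf_lt1; lra.
move=> n x /[dup] ax1 /andP[ax x1].
have x0 : 0 < x by apply: lt_le_trans ax.
have axx : a * x <= 1 by rewrite mulr_ile1 ?(ltW a0) ?(ltW x0)//; move: a2; lra.
rewrite /D ler_pdivrMr ?corr_gt0// [leRHS]mulrC ler_pdivlMr; last lra.
have ax0 : 0 <= a * x by rewrite mulr_ge0// ltW.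
have := corr_pow n ax0; rewrite mulrA -exprSr; apply: le_trans.
rewrite exprSr -mulrA det_corr_pow// -mulrA ler_pM2l ?invr_gt0 ?exprn_gt0//.
apply: le_trans (he _ ax1); rewrite mulrDr mulr1 lerD2l ger_pMl//.
rewrite det_corr_scale// det_corr_top//.
by have := cantor_le1 Fm F1 ((x - rho) / a ^+ 2); lra.
Qed.

(** The exponent is the least n with a^(n+1) <= r; its minimality, or r <= 1 when n = 0, gives r <=
    a^n. *)
Lemma unit_scale (r : R) : 0 < r <= 1 ->
  exists n, exists2 x, a <= x <= 1 & r = a ^+ n * x.
Proof.
move=> /andP[r0 r1]; have [n0 n0r] := exp_small a0 a2 r0.
have exP : exists n, a ^+ n.+1 <= r.
  exists n0; rewrite (le_trans _ (ltW n0r))// exprS ger_pMl ?exprn_gt0//.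
  by move: a2; lra.
have [n nr nmin] := ex_minnP exP.
have an : 0 < a ^+ n by rewrite exprn_gt0.
exists n, (r / a ^+ n); last by rewrite mulrC divfK// gt_eqF.
rewrite ler_pdivlMr// -exprS nr ler_pdivrMr// mul1r /=.
case: n nr nmin {an} => [|n] _ nmin; first by rewrite expr0.
by rewrite leNgt; apply/negP => /ltW /nmin; rewrite ltnn.
Qed.

End ScalarDeterminism.

(** * Probabilities determined by cylinders *)

Section RealProbability.
Context d (T : measurableType d) (R : realType) (P : probability T R).
Implicit Types A B : set T.

(** Real-valued, so that linear arithmetic applies to probabilities. *)
Definition pr A : R := fine (P A).

Lemma prE A : measurable A -> P A = (pr A)%:E.
Proof. by move=> mA; rewrite /pr fineK// fin_num_measure. Qed.

Lemma pr_ge0 A : 0 <= pr A. Proof. exact: fine_ge0. Qed.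

Lemma pr_mono A B : measurable A -> measurable B -> A `<=` B -> pr A <= pr B.
Proof.
by move=> mA mB AB; rewrite -lee_fin -!prE// le_measure ?inE.
Qed.

Lemma prT : pr [set: T] = 1. Proof. by rewrite /pr probability_setT. Qed.

Lemma pr_le1 A : measurable A -> pr A <= 1.
Proof. by move=> mA; rewrite -prT pr_mono. Qed.

Lemma pr0 : pr set0 = 0. Proof. by rewrite /pr measure0. Qed.

Lemma prU A B : measurable A -> measurable B -> A `&` B = set0 ->
  pr (A `|` B) = pr A + pr B.
Proof.
move=> mA mB AB; apply: EFin_inj.
rewrite EFinD -!prE ?measureU//; exact: measurableU.
Qed.

Lemma pr_split A B : measurable A -> measurable B ->
  pr A = pr (A `&` B) + pr (A `&` ~` B).
Proof.
move=> mA mB; have mC := measurableC mB.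
rewrite -prU; [|exact: measurableI|exact: measurableI|].
  by rewrite -setIUr setUv setIT.
by rewrite setIACA setICr setI0.
Qed.

Lemma prC A : measurable A -> pr (~` A) = 1 - pr A.
Proof.
by move=> mA; rewrite -prT (pr_split measurableT mA) !setTI addrC addKr.
Qed.

Lemma pr_ae B A : measurable B -> pr B = 1 -> measurable A ->
  pr (A `&` B) = pr A.
Proof.
move=> mB B1 mA; have mC := measurableC mB; rewrite [RHS](pr_split mA mB).
suff -> : pr (A `&` ~` B) = 0 by rewrite addr0.
apply/eqP; rewrite eq_le pr_ge0 andbT.
have -> : 0 = pr (~` B) by rewrite prC// B1 subrr.
by apply: pr_mono => //; exact: measurableI.
Qed.

Lemma pr_eq_on B A A' : measurable B -> pr B = 1 -> measurable A ->
  measurable A' -> (forall x, B x -> A x <-> A' x) -> pr A = pr A'.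
Proof.
move=> mB B1 mA mA' h; rewrite -(pr_ae mB B1 mA) -(pr_ae mB B1 mA').
by congr pr; apply/seteqP; split=> x [] /[swap] Bx /(h _ Bx) ?; split.
Qed.

End RealProbability.

(** * Balanced mixtures and images of probabilities *)

Section FairMixture.
Context d (T : measurableType d) (R : realType).
Variables P Q : probability T R.

Definition fairmix : set T -> \bar R :=
  measure_add (mscale (2^-1)%:nng P) (mscale (2^-1)%:nng Q).

HB.instance Definition _ := Measure.on fairmix.

Let fairmixE A : fairmix A = ((2^-1)%:E * P A + (2^-1)%:E * Q A)%E.
Proof. exact: measure_addE. Qed.

Let fairmix_setT : fairmix [set: T] = 1%E.
Proof.
by rewrite fairmixE !probability_setT !mule1 -EFinD; congr EFin; lra.
Qed.

HB.instance Definition _ := Measure_isProbability.Build _ _ _ fairmix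
  fairmix_setT.

Lemma pr_fairmix A : measurable A ->
  pr fairmix A = 2^-1 * (pr P A + pr Q A).
Proof.
move=> mA; transitivity (fine ((2^-1)%:E * P A + (2^-1)%:E * Q A)%E).
  by congr fine; exact: fairmixE.
by rewrite !prE// -!EFinM -EFinD /= mulrDr.
Qed.

End FairMixture.

Section Image.
Context d d' (T : measurableType d) (T' : measurableType d') (R : realType).
Variables (P : probability T R) (f : T -> T') (mf : measurable_fun setT f).

Let fm : {mfun T >-> T'} := HB.pack f (isMeasurableFun.Build _ _ _ _ f mf).

Definition image_probability : probability T' R := distribution P fm.

Lemma image_probabilityE A : image_probability A = P (f @^-1` A).
Proof. by []. Qed.

End Image.

(** * Cylinders and the measures that they determine *)

Section Cylinders.
Variables (R : realType) (a : R).
Hypotheses (a0 : 0 < a) (a2 : a < 2^-1).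

Definition branch (b : bool) (x : R) : R := (1 - a) * b%:R + a * x.

Lemma branch0E x : branch false x = a * x.
Proof. by rewrite /branch mulr0 add0r. Qed.

Lemma branch1E x : branch true x = 1 - a + a * x.
Proof. by rewrite /branch mulr1. Qed.

(** The left endpoints [kappa a u] of the cylinders of level k, generated by appending a last
    digit. *)
Inductive endpoint : nat -> R -> Prop :=
| Endpoint0 : endpoint 0 0
| EndpointS k x (b : bool) : endpoint k x ->
  endpoint k.+1 (x + (1 - a) * b%:R * a ^+ k).

Definition basic_itv k (x : R) : set R := `[x, x + a ^+ k]%classic.

Lemma measurable_basic_itv k x :
  measurable (basic_itv k x : set (measurableTypeR R)).
Proof. exact: measurable_itv. Qed.

Lemma endpoint_kappa k x : endpoint k x ->
  exists u : k.-tuple bool, kappa a u = x.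
Proof.
elim=> [|{}k {}x b _ [u <-]].
  by exists [tuple]; rewrite /kappa big_ord0 mulr0.
exists [tuple of rcons u b]; rewrite /kappa big_ord_recr /= mulrDr mulrA.
congr (_ * _ + _ * _ * _).
  apply: eq_bigr => i _; congr (_%:R * _).
  by rewrite !(tnth_nth false) /= nth_rcons size_tuple ltn_ord.
by rewrite (tnth_nth false) /= nth_rcons size_tuple ltnn eqxx.
Qed.

(** Self-similarity removes the first digit, whereas [endpoint] appends the last one; this passes
    from one to the other. *)
Lemma endpoint_head k x : endpoint k.+1 x ->
  exists b y, endpoint k y /\ x = branch b y.
Proof.
elim: k x => [|k IH] x h; inversion h as [|k' y b hy]; subst.
  inversion hy; subst; exists b, 0; split; first exact: Endpoint0.
  by rewrite /branch mulr0 addr0 expr0 mulr1 add0r.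
have [b' [z [hz ->]]] := IH _ hy.
exists b', (z + (1 - a) * b%:R * a ^+ k); split; first exact: EndpointS.
by rewrite /branch exprS; ring.
Qed.

Lemma endpoint_itv k x : endpoint k x -> 0 <= x /\ x + a ^+ k <= 1.
Proof.
elim=> [|{}k {}x b _ [x0 x1]]; first by rewrite expr0 add0r.
have ak := exprn_gt0 k a0; have a21 := a2.
have h : 0 <= (1 - a) * a ^+ k by apply: mulr_ge0; [lra|exact: ltW].
rewrite exprS; case: b; first by rewrite mulr1; lra.
by rewrite mulr0 mul0r addr0; split=> //; lra.
Qed.

Lemma basic_itv_split k x :
  [/\ basic_itv k.+1 x `<=` basic_itv k x,
      basic_itv k.+1 (x + (1 - a) * a ^+ k) `<=` basic_itv k x &
      x + a ^+ k.+1 < x + (1 - a) * a ^+ k].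
Proof.
have ak := exprn_gt0 k a0; have a21 := a2; rewrite /basic_itv exprS.
have h : 0 < (1 - 2 * a) * a ^+ k by apply: mulr_gt0; [lra|].
have h2 := mulr_gt0 a0 ak.
by split=> [y|y|]; rewrite /= ?in_itv /=; lra.
Qed.

Section Uniqueness.
Variables m1 m2 : probability (measurableTypeR R) R.
Hypotheses (m1E : forall k x, endpoint k x -> pr m1 (basic_itv k x) = 2 ^- k)
  (m2E : forall k x, endpoint k x -> pr m2 (basic_itv k x) = 2 ^- k).

(** The two children are disjoint and together have the mass of their parent, so the gap between
    them is null. *)
Let split_basic (m : probability (measurableTypeR R) R) (A : set R) k x :
  measurable (A : set (measurableTypeR R)) ->
  (forall k x, endpoint k x -> pr m (basic_itv k x) = 2 ^- k) ->
  endpoint k x ->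
  pr m (A `&` basic_itv k x) = pr m (A `&` basic_itv k.+1 x) +
    pr m (A `&` basic_itv k.+1 (x + (1 - a) * a ^+ k)).
Proof.
move=> mA mE hx; have [h1 h2 h3] := basic_itv_split k x.
have e1 := EndpointS false hx; have e2 := EndpointS true hx.
rewrite mulr0 mul0r addr0 in e1; rewrite mulr1 in e2.
move: (mE _ _ e1) (mE _ _ e2) (mE _ _ hx); rewrite exprS invfM.
set I := basic_itv k x; set I1 := basic_itv k.+1 x in h1 *.
set I2 := basic_itv k.+1 _ in h2 * => p1 p2 p.
have mI : measurable (I : set (measurableTypeR R)) by exact:
  measurable_basic_itv.
have mI1 : measurable (I1 : set (measurableTypeR R)) by exact:
  measurable_basic_itv.
have mI2 : measurable (I2 : set (measurableTypeR R)) by exact: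
  measurable_basic_itv.
have d12 : I1 `&` I2 = set0.
  apply/seteqP; split=> y //; rewrite /I1 /I2 /basic_itv /= !in_itv /=; lra.
have U : I1 `|` I2 `<=` I by move=> y [/h1|/h2].
have mU : measurable (I1 `|` I2 : set (measurableTypeR R)) by exact:
  measurableU.
have z : pr m (I `&` ~` (I1 `|` I2)) = 0.
  have := pr_split m mI mU; rewrite (setIidr U) prU// p1 p2 p; lra.
have mC := measurableC mU.
rewrite (pr_split m (measurableI _ _ mA mI) mU).
have -> : pr m (A `&` I `&` ~` (I1 `|` I2)) = 0.
  apply/eqP; rewrite eq_le pr_ge0 andbT -z; apply: pr_mono.
  - by apply: measurableI => //; exact: measurableI.
  - exact: measurableI.
  - by apply: setSI; exact: subIsetr.
rewrite addr0 -setIA (setIidr U) setIUr prU//; try exact: measurableI.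
by rewrite setIACA d12 setI0.
Qed.

(** A ray misses or contains one of the two children, where the measures agree, so the discrepancy
    passes to the other child; after n levels it is at most the mass of one cylinder. *)
Let diff_bound t n k x : endpoint k x ->
  `|pr m1 (`]-oo, t[%classic `&` basic_itv k x) -
    pr m2 (`]-oo, t[%classic `&` basic_itv k x)| <= 2 ^- (k + n).
Proof.
have mt : measurable (`]-oo, t[%classic : set (measurableTypeR R)).
  exact: measurable_itv.
elim: n k x => [|n IH] k x hx.
  have mI := measurable_basic_itv k x.
  have h (m : probability (measurableTypeR R) R) :
      pr m (basic_itv k x) = 2 ^- k ->
      0 <= pr m (`]-oo, t[%classic `&` basic_itv k x) <= 2 ^- k.
    move=> <-; rewrite pr_ge0 /= pr_mono//; exact: measurableI.
  move: (h _ (m1E hx)) (h _ (m2E hx)); rewrite addn0 ler_norml; lra.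
rewrite (split_basic mt m1E hx) (split_basic mt m2E hx).
have e1 := EndpointS false hx; have e2 := EndpointS true hx.
rewrite mulr0 mul0r addr0 in e1; rewrite mulr1 in e2.
have [_ _ h] := basic_itv_split k x.
have [tx|tx] := leP t (x + (1 - a) * a ^+ k).
  have -> : `]-oo, t[%classic `&` basic_itv k.+1 (x + (1 - a) * a ^+ k) = set0.
    by apply/seteqP; split=> y //; rewrite /basic_itv /= !in_itv /=; lra.
  by rewrite !pr0 !addr0 addnS -addSn IH.
have -> : `]-oo, t[%classic `&` basic_itv k.+1 x = basic_itv k.+1 x.
  by apply: setIidr => y; rewrite /basic_itv /= !in_itv /=; lra.
by rewrite m1E// m2E// opprD addrACA subrr add0r addnS -addSn IH.
Qed.

Lemma cylinder_measure_unique (A : set R) :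
  measurable (A : set (measurableTypeR R)) -> m1 A = m2 A.
Proof.
have full (m : probability (measurableTypeR R) R) (B : set R) :
    pr m (basic_itv 0 0) = 1 -> measurable (B : set (measurableTypeR R)) ->
    pr m (B `&` basic_itv 0 0) = pr m B.
  by move=> mI1 mB; apply: pr_ae => //; exact: measurable_basic_itv.
have one1 := m1E Endpoint0; have one2 := m2E Endpoint0.
rewrite expr0 invr1 in one1 one2.
have E t : m1 `]-oo, t[%classic = m2 `]-oo, t[%classic.
  have mt : measurable (`]-oo, t[%classic : set (measurableTypeR R)).
  exact: measurable_itv.
  rewrite !prE//; congr EFin; apply/eqP; rewrite -subr_eq0 -normr_le0.
  apply: half_pow_small => n.
  rewrite -(full m1 _ one1 mt) -(full m2 _ one2 mt).
  by have := diff_bound t n Endpoint0.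
move=> mA.
apply: (@measure_unique _ R (measurableTypeR R)
  (@RGenInftyO.G R) (fun n => `]-oo, n%:R[%classic)) => //.
- exact: RGenInftyO.measurableE.
- move=> _ _ [x ->] [y ->]; exists (Num.min x y).
  by apply/seteqP; split=> z; rewrite /= !in_itv /= lt_min => /andP.
- by move=> n; exists n%:R.
- apply/seteqP; split=> x // _; exists (Num.bound `|x|) => //.
  by rewrite /= in_itv /= (le_lt_trans (ler_norm x))// archi_boundP.
- by move=> _ [x ->]; exact: E.
- move=> n; apply: le_lt_trans (probability_le1 _ _) (ltry _).
  exact: measurable_itv.
Qed.

End Uniqueness.
End Cylinders.

(** * Self-similarity of the measure *)

Section SelfSimilarity.
Variables (R : realType) (a : R).
Hypotheses (a0 : 0 < a) (a2 : a < 2^-1).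
Variable mu : probability (measurableTypeR R) R.
Hypothesis mu_a : is_mu_alpha a mu.

Let br := branch a.
Notation mset A := (measurable (A : set (measurableTypeR R))).

Lemma pr_unit_itv : pr mu (`[0, 1]%classic) = 1.
Proof. by rewrite /pr mu_a.1. Qed.

Let munit : mset (`[0, 1]%classic : set R).
Proof. exact: measurable_itv. Qed.

Lemma pr_basic_itv k x : endpoint a k x -> pr mu (basic_itv a k x) = 2 ^- k.
Proof.
case: k => [|k] hx.
  inversion hx; rewrite /basic_itv expr0 add0r invr1; exact: pr_unit_itv.
have [u ux] := endpoint_kappa hx.
have := mu_a.2 k.+1 u isT; rewrite /cylinder ux -/(basic_itv _ _ _).
by rewrite /pr => ->.
Qed.

Lemma measurable_branch b :
  measurable_fun [set: measurableTypeR R] (br b : _ -> measurableTypeR R).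
Proof.
apply: measurable_funD; first exact: measurable_cst.
by apply: measurable_funM; [exact: measurable_cst|exact: measurable_id].
Qed.

Let mix := fairmix (image_probability mu (measurable_branch false))
  (image_probability mu (measurable_branch true)).

Let mpre b (B : set R) : mset B -> mset (br b @^-1` B).
Proof.
by move=> mB; have := measurable_branch b measurableT mB; rewrite setTI.
Qed.

Let pr_mix (B : set R) : mset B ->
  pr mix B = 2^-1 * (pr mu (br false @^-1` B) + pr mu (br true @^-1` B)).
Proof. by move=> mB; rewrite pr_fairmix. Qed.

(** A cylinder with leading digit b is pulled back by branch b to a cylinder one level lower, and by
    the other branch to a null set. *)
Let mix_basic_itv k x : endpoint a k x -> pr mix (basic_itv a k x) = 2 ^- k.
Proof.
move=> hx; have a21 := a2; have a01 := a0.
have mI := measurable_basic_itv a k x.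
rewrite pr_mix//; have hb b := mpre b mI.
case: k hx mI hb => [|k] hx mI hb.
  have full b : pr mu (br b @^-1` basic_itv a 0 x) = 1.
    rewrite -pr_unit_itv; apply: (pr_eq_on munit pr_unit_itv) => // y.
    rewrite /= in_itv /= => y01; split=> //= _.
    inversion hx; rewrite /basic_itv /= in_itv /= expr0 add0r /br /branch.
    have : 0 <= a * y <= a by rewrite mulr_ge0 ?(ltW a0) ?ler_piMr//; lra.
    by case: (b); rewrite ?mulr1 ?mulr0; lra.
  by rewrite !full expr0 invr1; lra.
have [b [y [hy xE]]] := endpoint_head hx.
have [y0 y1] := endpoint_itv a0 a2 hy.
have same : br b @^-1` basic_itv a k.+1 x = basic_itv a k y.
  apply/seteqP; split=> z;
    rewrite /basic_itv /= !in_itv /= xE /br /branch exprS;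
    by rewrite -addrA -mulrDr !lerD2l !ler_pM2l.
have diff : pr mu (br (~~ b) @^-1` basic_itv a k.+1 x) = 0.
  rewrite -(pr0 mu); apply: (pr_eq_on munit pr_unit_itv) => // z.
  rewrite /= in_itv /= => z01; split=> //; rewrite /basic_itv /= in_itv /=.
  rewrite xE /br /branch exprS -addrA -mulrDr.
  have : 0 <= a * z <= a by rewrite mulr_ge0 ?(ltW a0) ?ler_piMr//; lra.
  have : 0 <= a * y by rewrite mulr_ge0 ?(ltW a0).
  have : a * (y + a ^+ k) <= a by rewrite ler_piMr// ltW.
  case: (b) => /=; rewrite mulr1 mulr0; lra.
case: b same diff {xE} => /= -> ->;
  by rewrite ?addr0 ?add0r pr_basic_itv// exprS invfM.
Qed.

(** The mixture [mix] has the same cylinder masses as [mu], and these determine the measure. *)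
Lemma pr_branch (B : set R) : mset B ->
  pr mu B = 2^-1 * (pr mu (br false @^-1` B) + pr mu (br true @^-1` B)).
Proof.
move=> mB; rewrite -pr_mix// /pr; congr fine.
exact: (cylinder_measure_unique a0 a2 pr_basic_itv mix_basic_itv).
Qed.

(** At most one branch reaches a given point from [0, 1], so every removed digit halves the bound on
    the mass of points. *)
Lemma pr_set1 x : pr mu [set x] = 0.
Proof.
have a21 := a2; have a01 := a0.
have m1 y : mset [set y] by exact: measurable_set1.
have mb b y := mpre b (m1 y).
have h n : forall y, pr mu [set y] <= 2 ^- n.
  elim: n => [y|n IH y]; first by rewrite expr0 invr1 pr_le1.
  rewrite pr_branch// exprS invfM ler_pM2l ?invr_gt0//.
  have [ya|ya] := leP y a.
    have -> : pr mu (br true @^-1` [set y]) = 0.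
      rewrite -(pr0 mu); apply: (pr_eq_on munit pr_unit_itv) => // z.
      rewrite /= in_itv /= => z01; split=> //; rewrite /br /branch mulr1.
      by have := mulr_ge0 (ltW a0) (andP z01).1; lra.
    rewrite addr0; apply: le_trans (IH (y / a)); apply: pr_mono => // z /= <-.
    by rewrite /br /branch mulr0 add0r mulrC mulKf// gt_eqF.
  have -> : pr mu (br false @^-1` [set y]) = 0.
    rewrite -(pr0 mu); apply: (pr_eq_on munit pr_unit_itv) => // z.
    rewrite /= in_itv /= => z01; split=> //; rewrite /br /branch mulr0 add0r.
    have : a * z <= a by rewrite ler_piMr ?(ltW a0)//; lra.
    lra.
  rewrite add0r; apply: le_trans (IH ((y - (1 - a)) / a)).
  apply: pr_mono => // z /= <-.
  by rewrite /br /branch mulr1 addrAC subrr add0r mulrC mulKf// gt_eqF.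
apply/eqP; rewrite eq_le pr_ge0 andbT; apply: half_pow_small => n.
exact: h.
Qed.

End SelfSimilarity.

(** * The product of [mu] with itself *)

Section Square.
Variables (R : realType) (mu : probability (measurableTypeR R) R).
Notation RR := (measurableTypeR R * measurableTypeR R)%type.
Notation sq := (mu \x mu)%E.

Lemma square_unique (m : probability RR R) :
  (forall A B : set (measurableTypeR R), measurable A -> measurable B ->
    pr m (A `*` B) = pr mu A * pr mu B) ->
  forall E, measurable E -> pr sq E = pr m E.
Proof.
move=> h E mE; rewrite /pr; congr fine.
apply: product_measure_unique => // A B mA mB.
have mAB : measurable (A `*` B) by exact: measurableX.
transitivity (pr m (A `*` B))%:E; first exact: prE.
by rewrite h// EFinM; congr (_ * _)%E; rewrite -prE.
Qed.

Lemma pr_square_rect (A B : set (measurableTypeR R)) :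
  measurable A -> measurable B -> pr sq (A `*` B) = pr mu A * pr mu B.
Proof.
move=> mA mB; transitivity (fine (mu A * mu B)%E).
  by congr fine; exact: product_measure1E.
by rewrite (prE mu mA) (prE mu mB).
Qed.

Lemma pr_square_le (E : set RR) (e : R) : measurable E ->
  (forall x, pr mu (xsection E x) <= e) -> pr sq E <= e.
Proof.
move=> mE h; rewrite -lee_fin -(prE sq mE) /product_measure1.
apply: (@le_trans _ _ (\int[mu]_x (cst e%:E x))%E).
  apply: ge0_le_integral => //=.
  - exact: measurable_fun_xsection.
  - by move=> x _; rewrite (prE mu (measurable_xsection x mE)) lee_fin h.
by rewrite integral_cst//= probability_setT mule1.
Qed.

Lemma pr_square_swap (E : set RR) : measurable E ->
  pr sq [set p | E (p.2, p.1)] = pr sq E.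
Proof.
move=> mE; apply/esym.
have ms : measurable_fun setT (fun p : RR => (p.2, p.1)).
  by apply: measurable_fun_pair.
apply: (@square_unique (image_probability sq ms)) => //.
move=> A B mA mB; rewrite mulrC -pr_square_rect//.
transitivity (pr sq [set p | (A `*` B) (p.2, p.1)]) => //; congr pr.
by apply/seteqP; split=> -[x y] [].
Qed.

Lemma pr_square_map2 (f : measurableTypeR R -> measurableTypeR R) :
  measurable_fun setT f ->
  (forall B, measurable B -> pr mu (f @^-1` B) = pr mu B) ->
  forall E : set RR, measurable E ->
  pr sq [set p | E (p.1, f p.2)] = pr sq E.
Proof.
move=> mf hf E mE; apply/esym.
have mg : measurable_fun setT (fun p : RR => (p.1, f p.2)).
  by apply: measurable_fun_pair => //; exact: measurableT_comp.
apply: (@square_unique (image_probability sq mg)) => // A B mA mB.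
rewrite -(hf _ mB) -pr_square_rect//.
by rewrite -[X in measurable X]setTI; exact: mf.
Qed.

End Square.

(** * The map *)

Section AddingMachine.
Variables (R : realType) (a : R).
Hypotheses (a0 : 0 < a) (a2 : a < 2^-1).

Let f := falpha a.
Let br := branch a.
Let shift_dom j : set R := `[1 - a ^+ j, 1 - a ^+ j + a ^+ j.+1]%classic.
Let gap_dom j : set R := `]1 - a ^+ j + a ^+ j.+1, 1 - a ^+ j.+1[%classic.

Lemma falpha_cover (x : R) : 0 <= x <= 1 ->
  [\/ x = 1, exists j, x \in `[1 - a ^+ j, 1 - a ^+ j + a ^+ j.+1] |
      exists j, x \in `]1 - a ^+ j + a ^+ j.+1, 1 - a ^+ j.+1[].
Proof.
move=> /andP[x0 x1]; have [->|xn1] := eqVneq x 1; first by constructor 1.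
have r : 0 < 1 - x <= 1.
  by rewrite subr_gt0 lt_neqAle xn1 x1 /= lerBlDr lerDl.
have [n [y /andP[ay y1] xy]] := unit_scale a0 a2 r.
have an := exprn_gt0 n a0; have an1 := exprn_gt0 n.+1 a0.
have an2 := exprn_gt0 n.+2 a0.
have h1 : 1 - x <= a ^+ n by rewrite xy ger_pMr.
have h2 : a ^+ n.+1 <= 1 - x by rewrite xy exprSr ler_pM2l.
have [xs|xs] := leP x (1 - a ^+ n + a ^+ n.+1).
  by constructor 2; exists n; rewrite in_itv /= xs andbT; lra.
have [xg|xg] := ltP x (1 - a ^+ n.+1).
  by constructor 3; exists n; rewrite in_itv /= xs xg.
(* Only x = 1 - a^(n+1) remains, the left end of the next shift piece. *)
by constructor 2; exists n.+1; rewrite in_itv /=; lra.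
Qed.

Lemma falpha_branch0 (x : R) : 0 <= x <= 1 -> f (br false x) = br true x.
Proof.
move=> /andP[x0 x1]; rewrite /f (falpha_shift a0 a2 (j := 0)).
  by rewrite /br branch0E branch1E expr0 expr1; ring.
rewrite in_itv /= /br branch0E expr0 expr1 subrr add0r.
by rewrite mulr_ge0 ?(ltW a0)//= ler_piMr// ltW.
Qed.

(** This is the carry of the adding machine: T1 sends the pieces of index j into those of index j +
    1, and the affine formulas scale accordingly, on the gaps too. *)
Lemma falpha_branch1 (x : R) : 0 <= x <= 1 ->
  f (br true x) = br false (f x).
Proof.
move=> /falpha_cover[->|[j xj]|[j xj]]; rewrite /f /br branch0E branch1E.
- by rewrite mulr1 subrK !falpha1// mulr0.
- rewrite (falpha_shift a0 a2 xj) (falpha_shift a0 a2 (j := j.+1)).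
    by rewrite !exprS; ring.
  move: xj; rewrite !in_itv /= !exprS; move: (a ^+ j) => p /andP[xp xq].
  rewrite -(ler_pM2l a0) in xp; rewrite -(ler_pM2l a0) in xq.
  by lra.
- rewrite (falpha_gap a0 a2 xj) (falpha_gap a0 a2 (j := j.+1)).
    by rewrite [a ^+ j.+3]exprS; ring.
  move: xj; rewrite !in_itv /= !exprS; move: (a ^+ j) => p /andP[xp xq].
  rewrite -(ltr_pM2l a0) in xp; rewrite -(ltr_pM2l a0) in xq.
  by lra.
Qed.

Lemma falpha_unit (x : R) : 0 <= x <= 1 -> 0 <= f x <= 1.
Proof.
have a21 := a2; have a01 := a0.
move=> /falpha_cover[->|[j xj]|[j xj]]; rewrite /f.
- by rewrite falpha1// lexx ler01.
- rewrite (falpha_shift a0 a2 xj); move: xj; rewrite in_itv /= => /andP[].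
  have := exprn_gt0 j a0; have : a ^+ j <= 1 by rewrite exprn_ile1 ?ltW//; lra.
  have : a * a ^+ j <= a ^+ j by rewrite ger_pMl ?exprn_gt0//; lra.
  by rewrite exprS; move: (a ^+ j) (a * a ^+ j) => p q; lra.
- rewrite (falpha_gap a0 a2 xj); move: xj; rewrite in_itv /= => /andP[].
  have p0 := exprn_gt0 j a0;
    have p1 : a ^+ j <= 1 by rewrite exprn_ile1 ?ltW//; lra.
  rewrite (exprS a j.+1) (exprS a j); move: (a ^+ j) p0 p1 => p p0 p1 h1 h2.
  have w0 : 0 < 1 - 2 * a by lra.
  have m0 : 0 < 1 - a + a ^+ 2 by have := exprn_gt0 2 a0; lra.
  have -> : (1 - a + a ^+ 2) / (2 * a - 1) * (x - 1) +
      a * (a * p) * ((2 - a) / (2 * a - 1)) =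
      ((1 - a + a ^+ 2) * (1 - x) - a * (a * p) * (2 - a)) / (1 - 2 * a).
    have nz : 1 - 2 * a != 0 by rewrite gt_eqF.
    have nz' : 2 * a - 1 != 0 by rewrite lt_eqF//; lra.
    by field; rewrite ?nz ?nz'.
  (* The piece is affine and decreasing; its limits at the two ends of the gap are p and a p (1 -
     a), with p = a^j. *)
  have k1 : (1 - a + a ^+ 2) * (a * p) < (1 - a + a ^+ 2) * (1 - x).
    by rewrite ltr_pM2l//; lra.
  have k2 : (1 - a + a ^+ 2) * (1 - x) < (1 - a + a ^+ 2) * (p - a * p).
    by rewrite ltr_pM2l//; lra.
  have k3 : 0 < p * a * (1 - a) * (1 - 2 * a).
    by rewrite !mulr_gt0//; lra.
  apply/andP; split.
    apply: divr_ge0; last exact: ltW.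
    suff : 0 < (1 - a + a ^+ 2) * (a * p) - a * (a * p) * (2 - a) by lra.
    suff -> : (1 - a + a ^+ 2) * (a * p) - a * (a * p) * (2 - a) =
      p * a * (1 - a) * (1 - 2 * a) by [].
    by ring.
  rewrite ler_pdivrMr// mul1r.
  suff : (1 - a + a ^+ 2) * (p - a * p) - a * (a * p) * (2 - a) <= 1 - 2 * a.
    by lra.
  have -> : (1 - a + a ^+ 2) * (p - a * p) - a * (a * p) * (2 - a) =
    p * (1 - 2 * a) by ring.
  by rewrite ger_pMl.
Qed.

Lemma measurable_falpha :
  measurable_fun [set: measurableTypeR R] (f : _ -> measurableTypeR R).
Proof.
have mS j : measurable (shift_dom j : set (measurableTypeR R)).
  exact: measurable_itv.
have mG j : measurable (gap_dom j : set (measurableTypeR R)).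
  exact: measurable_itv.
have m1 : measurable ([set 1] : set (measurableTypeR R)) by exact:
  measurable_set1.
have mU : measurable (~` `[0, 1]%classic : set (measurableTypeR R)).
  by apply: measurableC; exact: measurable_itv.
have mbS : measurable (\bigcup_j shift_dom j : set (measurableTypeR R)).
  exact: bigcupT_measurable.
have mbG : measurable (\bigcup_j gap_dom j : set (measurableTypeR R)).
  exact: bigcupT_measurable.
have maff (u v : R) (D : set (measurableTypeR R)) :
    (forall x, D x -> f x = u * x + v) ->
    measurable_fun D (f : measurableTypeR R -> measurableTypeR R).
  move=> h; apply: (@eq_measurable_fun _ _ (measurableTypeR R)
    (measurableTypeR R) D (fun x => u * x + v)).
    by move=> x; rewrite inE => /h.
  apply: measurable_funD; last exact: measurable_cst.
  by apply: measurable_funM; [exact: measurable_cst|exact: measurable_id].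
have -> : [set: measurableTypeR R] = (\bigcup_j shift_dom j `|` \bigcup_j
  gap_dom j)
    `|` ([set 1] `|` ~` `[0, 1]%classic).
  apply/seteqP; split=> // x _.
  have [x01|x01] := boolP (0 <= x <= 1); last first.
    by right; right; rewrite /= in_itv /=; exact/negP.
  have [->|[j xj]|[j xj]] := falpha_cover x01.
  - by right; left.
  - by left; left; exists j.
  - by left; right; exists j.
apply/measurable_funU; [exact: measurableU|exact: measurableU|].
split; apply/measurable_funU => //; split.
- apply/measurable_fun_bigcup => // j.
  apply: (maff 1 (- 1 + 2 * a ^+ j - a ^+ j.+1)) => x xj.
  by rewrite /f (falpha_shift a0 a2 xj); ring.
- apply/measurable_fun_bigcup => // j.
  apply: (maff ((1 - a + a ^+ 2) / (2 * a - 1)) (a ^+ j.+2 *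
    ((2 - a) / (2 * a - 1)) - (1 - a + a ^+ 2) / (2 * a - 1))) => x xj.
  by rewrite /f (falpha_gap a0 a2 xj); ring.
- by apply: (maff 0 0) => x ->; rewrite /f falpha1// mul0r addr0.
- apply: (maff 0 0) => x; rewrite /= in_itv /= => x01.
  rewrite mul0r addr0 /f /falpha.
  (* Outside [0, 1] the graph is empty and [falpha] takes its default value 0. *)
  rewrite xgetPN// => y h; apply: x01; case: h => [j z|j z|].
  + rewrite in_itv /= => /andP[].
    have := exprn_gt0 j a0; have := exprn_gt0 j.+1 a0.
    have : a ^+ j <= 1 by rewrite exprn_ile1 ?(ltW a0)//; move: a2; lra.
    have : a * a ^+ j <= a ^+ j.
      by rewrite ger_pMl ?exprn_gt0//; move: a2; lra.
    by rewrite exprS; lra.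
  + rewrite in_itv /= => /andP[].
    have := exprn_gt0 j a0; have := exprn_gt0 j.+1 a0.
    have : a ^+ j <= 1 by rewrite exprn_ile1 ?(ltW a0)//; move: a2; lra.
    by lra.
  + by rewrite ler01 lexx.
Qed.

End AddingMachine.

(** * Correlation integrals *)

Section Correlation.
Variables (R : realType) (a : R).
Hypotheses (a0 : 0 < a) (a2 : a < 2^-1).
Variable mu : probability (measurableTypeR R) R.
Hypothesis mu_a : is_mu_alpha a mu.

Notation MR := (measurableTypeR R).
Notation RR := (MR * MR)%type.
Notation sq := (mu \x mu)%E.
Let f : MR -> MR := falpha a.
Let br := branch a.
Let c := (1 - a) / a.

Let ac : a * c = 1 - a.
Proof. by rewrite /c mulrC divfK// gt_eqF. Qed.

Let mf : measurable_fun setT f. Proof. exact: measurable_falpha. Qed.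

Let mu01 : pr mu (`[0, 1]%classic : set MR) = 1.
Proof. exact: pr_unit_itv mu_a. Qed.

Let m01 : measurable (`[0, 1]%classic : set MR).
Proof. exact: measurable_itv. Qed.

Let mbr b : measurable_fun setT (br b : MR -> MR).
Proof. exact: measurable_branch. Qed.

Let preimage_measurable (g : MR -> MR) B : measurable_fun setT g ->
  measurable B -> measurable (g @^-1` B).
Proof. by move=> mg mB; have := mg measurableT _ mB; rewrite setTI. Qed.

(** By the conjugacies of f with T0 and T1, the discrepancy for B is half the discrepancy for the
    preimage of B under T0; iteration makes it vanish. *)
Lemma falpha_invariant (B : set MR) : measurable B ->
  pr mu (f @^-1` B) = pr mu B.
Proof.
move=> mB; apply/eqP; rewrite -subr_eq0 -normr_le0; apply: half_pow_small => n.
elim: n B mB => [|n IH] B mB.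
  have := pr_ge0 mu B; have := pr_le1 mu mB.
  have mfB := preimage_measurable mf mB.
  have := pr_ge0 mu (f @^-1` B); have := pr_le1 mu mfB.
  by rewrite expr0 invr1 ler_norml; lra.
have mB0 := preimage_measurable (mbr false) mB.
have mB1 := preimage_measurable (mbr true) mB.
have mfB := preimage_measurable mf mB.
have := IH _ mB0.
rewrite (pr_branch a0 a2 mu_a mfB) (pr_branch a0 a2 mu_a mB) -/br.
have -> : pr mu (br false @^-1` (f @^-1` B)) = pr mu (br true @^-1` B).
  apply: (pr_eq_on m01 mu01) => //; first exact: preimage_measurable mfB.
  by move=> x; rewrite /= in_itv /= => /(falpha_branch0 a0 a2);
    rewrite /f /br => ->.
have -> : pr mu (br true @^-1` (f @^-1` B))
  = pr mu (f @^-1` (br false @^-1` B)).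
  apply: (pr_eq_on m01 mu01).
  - exact: preimage_measurable mfB.
  - exact: preimage_measurable mB0.
  by move=> x; rewrite /= in_itv /= => /(falpha_branch1 a0 a2);
    rewrite /f /br => ->.
rewrite exprS invfM !ler_norml; lra.
Qed.

Let bmap b b' (p : RR) : RR := (br b p.1, br b' p.2).

Let mbmap b b' : measurable_fun setT (bmap b b').
Proof. by apply: measurable_fun_pair; exact: measurableT_comp. Qed.

Let pre2 b b' E : measurable E -> measurable (bmap b b' @^-1` E).
Proof. by move=> mE; have := mbmap b b' measurableT mE; rewrite setTI. Qed.

(** The uniform mixture over the four pairs of leading digits agrees with the product on rectangles,
    by [pr_branch] in each coordinate. *)
Lemma pr_square_branch (E : set RR) : measurable E ->
  pr sq E = 4^-1 * (pr sq (bmap false false @^-1` E) +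
    pr sq (bmap false true @^-1` E) + pr sq (bmap true false @^-1` E) +
    pr sq (bmap true true @^-1` E)).
Proof.
pose im b b' := image_probability sq (mbmap b b').
pose mix := fairmix (fairmix (im false false) (im false true))
  (fairmix (im true false) (im true true)).
have mixE A : measurable A ->
  pr mix A = 4^-1 * (pr sq (bmap false false @^-1` A) +
    pr sq (bmap false true @^-1` A) + pr sq (bmap true false @^-1` A) +
    pr sq (bmap true true @^-1` A)).
  move=> mA; rewrite !pr_fairmix// /pr !image_probabilityE.
  by rewrite -!/(pr _ _); lra.
move=> mE; rewrite -mixE//; apply: square_unique => // A B mA mB.
have mAB : measurable (A `*` B) by exact: measurableX.
rewrite mixE//.
have h b b' : pr sq (bmap b b' @^-1` (A `*` B)) =
    pr mu (br b @^-1` A) * pr mu (br b' @^-1` B).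
  rewrite -pr_square_rect//; exact: preimage_measurable.
rewrite !h (pr_branch a0 a2 mu_a mA) (pr_branch a0 a2 mu_a mB) -/br; lra.
Qed.

Let unit (x : R) := 0 <= x <= 1.

Let sq_eq_on (A A' : set RR) : measurable A -> measurable A' ->
  (forall x y, unit x -> unit y -> A (x, y) <-> A' (x, y)) ->
  pr sq A = pr sq A'.
Proof.
move=> mA mA' h.
apply: (@pr_eq_on _ _ _ sq ((`[0, 1]%classic : set MR) `*` (`[0, 1]%classic :
  set MR))) => //.
- exact: measurableX.
- by rewrite pr_square_rect// mu01 mulr1.
- by move=> [x y] []; rewrite /= !in_itv /=; exact: h.
Qed.

Let sq_le_on (A A' : set RR) : measurable A -> measurable A' ->
  (forall x y, unit x -> unit y -> A (x, y) -> A' (x, y)) ->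
  pr sq A <= pr sq A'.
Proof.
move=> mA mA' h; have mAA := measurableI _ _ mA mA'.
rewrite (@sq_eq_on A (A `&` A'))//; first by apply: pr_mono => //;
  exact: subIsetr.
by move=> x y ux uy; split=> [Axy|[]//]; split=> //; exact: h.
Qed.

Let sq_one (A : set RR) : measurable A ->
  (forall x y, unit x -> unit y -> A (x, y)) -> pr sq A = 1.
Proof.
move=> mA h; rewrite -(prT sq); apply: sq_eq_on => // x y ux uy.
by split=> // _; exact: h.
Qed.

Let sq_zero (A : set RR) : measurable A ->
  (forall x y, unit x -> unit y -> ~ A (x, y)) -> pr sq A = 0.
Proof.
move=> mA h; rewrite -(pr0 sq); apply: sq_eq_on => // x y ux uy.
by split=> // Axy; case: (h _ _ ux uy).
Qed.

(** * The Cantor distribution function *)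

Definition cantor_fun (t : R) : R := pr mu (`]-oo, t]%classic : set MR).
Let F := cantor_fun.

Let mray t : measurable (`]-oo, t]%classic : set MR).
Proof. exact: measurable_itv. Qed.

Lemma cantor_fun_homo : {homo F : x y / x <= y}.
Proof.
move=> x y xy; apply: pr_mono => // z; rewrite /= !in_itv /=.
by move=> zx; exact: le_trans xy.
Qed.

Lemma cantor_fun_lt0 (x : R) : x < 0 -> F x = 0.
Proof.
move=> x0; rewrite -(pr0 mu); apply: (pr_eq_on m01 mu01) => // y.
by rewrite /= !in_itv /= => y01; split=> // yx; lra.
Qed.

Lemma cantor_fun_ge1 (x : R) : 1 <= x -> F x = 1.
Proof.
move=> x1; rewrite -(prT mu); apply: (pr_eq_on m01 mu01) => // y.
by rewrite /= !in_itv /= => y01; split=> // _; lra.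
Qed.

Lemma cantor_fun_scale (x : R) : F (a * x) = 2^-1 * (F x + F (x - c)).
Proof.
have e0 : br false @^-1` `]-oo, a * x]%classic = `]-oo, x]%classic.
  by apply/seteqP; split=> y; rewrite /= !in_itv /= /br branch0E ler_pM2l.
have e1 : br true @^-1` `]-oo, a * x]%classic = `]-oo, x - c]%classic.
  apply/seteqP; split=> y; rewrite /= !in_itv /= /br branch1E;
    by rewrite -(ler_pM2l a0 y) mulrBr ac; lra.
have := pr_branch a0 a2 mu_a (mray (a * x)).
by rewrite -/br e0 e1.
Qed.

(** * One-sided closeness of orbits *)

Let sep t (x y : MR) := forall i, iter i f x - iter i f y <= t.

Let iter_unit i x : unit x -> unit (iter i f x).
Proof. by move=> ux; elim: i => //= i; exact: falpha_unit. Qed.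

(** Two steps of f on [br b x] amount to one step on x, with leading digit b again; at odd times the
    leading digit is the other one. *)
Let iter_even b i x : unit x -> iter i.*2 f (br b x) = br b (iter i f x).
Proof.
move=> ux; elim: i => //= i ->; have ui := iter_unit i ux.
case: b; rewrite /f /br.
  by rewrite (falpha_branch1 a0 a2 ui)
    (falpha_branch0 a0 a2 (falpha_unit a0 a2 ui)).
by rewrite (falpha_branch0 a0 a2 ui) (falpha_branch1 a0 a2 ui).
Qed.

Let iter_odd0 i x : unit x ->
  iter i.*2.+1 f (br false x) = br true (iter i f x).
Proof.
by move=> ux; rewrite iterS iter_even//; apply: falpha_branch0 => //;
  exact: iter_unit.
Qed.

Let iter_odd1 i x : unit x ->
  iter i.*2.+1 f (br true x) = br false (iter i.+1 f x).
Proof.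
by move=> ux; rewrite iterS iter_even//; apply: falpha_branch1 => //;
  exact: iter_unit.
Qed.

Let parity_ind (Q : nat -> Prop) : (forall i, Q i.*2) ->
  (forall i, Q i.*2.+1) ->
  forall i, Q i.
Proof.
move=> h0 h1 i; rewrite -(odd_double_half i).
by case: (odd i); rewrite ?add1n ?add0n; [exact: h1|exact: h0].
Qed.

(** The two orbits have equal leading digits at all times, so these cancel and differences are
    scaled by a. *)
Let sep_diag b s x y : unit x -> unit y ->
  sep (a * s) (br b x) (br b y) <-> sep s x y.
Proof.
move=> ux uy; split=> h.
  move=> i; have := h i.*2; rewrite !iter_even// /br /branch.
  by rewrite opprD addrACA subrr add0r -mulrBr ler_pM2l.
apply: parity_ind => i.
  rewrite !iter_even// /br /branch.
  by rewrite opprD addrACA subrr add0r -mulrBr ler_pM2l.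
case: b; rewrite ?iter_odd0 ?iter_odd1// /br /branch.
  by rewrite opprD addrACA subrr add0r -mulrBr ler_pM2l.
by rewrite opprD addrACA subrr add0r -mulrBr ler_pM2l.
Qed.

Let unit_mul x : unit x -> 0 <= a * x <= a.
Proof. by move=> /andP[x0 x1];
  rewrite mulr_ge0 ?(ltW a0)//= ler_piMr// ltW. Qed.

(* At the alternate times the order of the two points is reversed, and the
   signed distance is then negative. *)
Let sep10 s x y : unit x -> unit y ->
  sep (a * s) (br true x) (br false y) <-> sep (s - c) x y.
Proof.
move=> ux uy; have a21 := a2; have e i : (iter i f x - iter i f y <= s - c) =
    (br true (iter i f x) - br false (iter i f y) <= a * s).
  by rewrite /br branch0E branch1E -(ler_pM2l a0) !mulrBr ac; apply/idP/idP;
    lra.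
split=> h; first by move=> i; rewrite e -!iter_even.
apply: parity_ind => i; first by rewrite !iter_even// -e.
have ui := unit_mul (iter_unit i ux); have vi := unit_mul (iter_unit i uy).
have := h i; rewrite e iter_odd0// iter_odd1// /br !branch0E !branch1E.
have := unit_mul (iter_unit i.+1 ux); lra.
Qed.

(** The decisive times are now the odd ones, at which y has already been moved once by the carry. *)
Let sep01 s x y : unit x -> unit y ->
  sep (a * s) (br false x) (br true y) <-> sep (s - c) x (f y).
Proof.
move=> ux uy; have a21 := a2;
  have e i : (iter i f x - iter i f (f y) <= s - c) =
    (br true (iter i f x) - br false (iter i.+1 f y) <= a * s).
  rewrite iterSr /br branch0E branch1E -(ler_pM2l a0) !mulrBr ac.
  by apply/idP/idP; lra.
split=> h; first by move=> i; rewrite e -iter_odd0// -iter_odd1.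
apply: parity_ind => i; last by rewrite iter_odd0// iter_odd1// -e.
have ui := unit_mul (iter_unit i ux); have vi := unit_mul (iter_unit i uy).
have := h i; rewrite e !iter_even// /br !branch0E !branch1E.
have := unit_mul (iter_unit i.+1 uy); lra.
Qed.

Let sep_ge1 s x y : 1 <= s -> unit x -> unit y -> sep s x y.
Proof.
move=> s1 ux uy i; have := iter_unit i ux; have := iter_unit i uy.
by rewrite /unit; lra.
Qed.

Let miter i : measurable_fun setT (iter i f).
Proof. by elim: i => [|i IH] /=;
  [exact: measurable_id|exact: measurableT_comp]. Qed.

Let msep (g h : RR -> MR) s : measurable_fun setT g -> measurable_fun setT h ->
  measurable [set p | sep s (g p) (h p)].
Proof.
move=> mg mh.
have -> : [set p | sep s (g p) (h p)] =
    \bigcap_i [set p | iter i f (g p) - iter i f (h p) <= s].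
  by apply/seteqP; split=> p /= hp i; [move=> _; exact: hp|exact: hp].
apply: bigcapT_measurable => i.
have mi : measurable_fun setT (fun p : RR => iter i f (g p) - iter i f (h p) :
  MR).
  by apply: measurable_funB; apply: measurableT_comp (miter i) _.
have := mi measurableT _ (mray s); rewrite setTI.
congr measurable; apply/seteqP; split=> p; by rewrite /= in_itv.
Qed.

Let m1 : measurable_fun setT (fst : RR ->
  MR). Proof. exact: measurable_fst. Qed.
Let m2 : measurable_fun setT (snd : RR ->
  MR). Proof. exact: measurable_snd. Qed.
Let mf1 : measurable_fun setT (fun p : RR => f p.1).
Proof. exact: measurableT_comp. Qed.
Let mf2 : measurable_fun setT (fun p : RR => f p.2).
Proof. exact: measurableT_comp. Qed.

Let Psi s := pr sq [set p | sep s p.1 p.2].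

Let psi_f s : pr sq [set p | sep s p.1 (f p.2)] = Psi s.
Proof. exact: (pr_square_map2 mf falpha_invariant (msep s m1 m2)). Qed.

Let psi_swap s : pr sq [set p | sep s p.2 p.1] = Psi s.
Proof. exact: (pr_square_swap mu (msep s m1 m2)). Qed.

Let psi_swap_f s : pr sq [set p | sep s p.2 (f p.1)] = Psi s.
Proof. by rewrite -psi_f; exact: (pr_square_swap mu (msep s m1 mf2)). Qed.

Let sq_branch (E : set RR) (S : bool -> bool -> set RR) : measurable E ->
  (forall b b', measurable (S b b')) ->
  (forall b b' x y, unit x -> unit y ->
    E (br b x, br b' y) <-> S b b' (x, y)) ->
  pr sq E = 4^-1 * (pr sq (S false false) + pr sq (S false true) +
    pr sq (S true false) + pr sq (S true true)).
Proof.
move=> mE mS h; rewrite (pr_square_branch mE).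
have e b b' : pr sq (bmap b b' @^-1` E) = pr sq (S b b').
  by apply: sq_eq_on => //; [exact: pre2|move=> x y; exact: h].
by rewrite !e.
Qed.

Let psi_scale s : Psi (a * s) = 2^-1 * (Psi s + Psi (s - c)).
Proof.
rewrite /Psi (@sq_branch _ (fun b b' =>
  if b then (if b' then [set p | sep s p.1 p.2] else [set p | sep (s - c)
    p.1 p.2])
  else (if b' then [set p | sep (s - c)
    p.1 (f p.2)] else [set p | sep s p.1 p.2]))).
- by rewrite psi_f -!/(Psi _); lra.
- exact: msep.
- by move=> [] []; exact: msep.
- move=> [] [] x y ux uy /=.
  + exact: sep_diag.
  + exact: sep10.
  + exact: sep01.
  + exact: sep_diag.
Qed.

Let psi_homo s t : s <= t -> Psi s <= Psi t.
Proof.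
move=> st; apply: pr_mono; [exact: msep|exact: msep|].
by move=> p h i; exact: le_trans (h i) st.
Qed.

Let c_gt1 : 1 < c. Proof. exact: ac_gt1 a0 a2 ac. Qed.

(** Scaling and monotonicity give Psi (a u) <= Psi u. Hence s = a^n u inherits the value 0 from some
    u < -1, which time 0 already excludes. *)
Let psi_lt0 s : s < 0 -> Psi s = 0.
Proof.
move=> s0; have c1 := c_gt1.
have [|n ns] := exp_small a0 a2 (x := - s); first by rewrite oppr_gt0.
have sE : s = a ^+ n * (s / a ^+ n) by rewrite mulrC divfK// gt_eqF// exprn_gt0.
have un : s / a ^+ n < -1 by rewrite ltr_pdivrMr ?exprn_gt0//; lra.
have Pu : Psi (s / a ^+ n) = 0.
  apply: sq_zero; first exact: msep.
  by move=> x y ux uy /(_ 0) /=; move: ux uy; rewrite /unit; lra.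
apply/eqP; rewrite eq_le pr_ge0 andbT -[in leRHS]Pu {1}sE.
elim: n {ns sE Pu un} (s / a ^+ n) => [|n IH] u; first by rewrite expr0 mul1r.
rewrite exprSr -mulrA; apply: le_trans (IH (a * u)) _.
rewrite psi_scale; have := @psi_homo (u - c) u; lra.
Qed.

Let psi_ge1 s : 1 <= s -> Psi s = 1.
Proof.
by move=> s1; apply: sq_one; [exact: msep|move=> x y; exact: sep_ge1].
Qed.

(** As c > 1, either u >= 1 or u - c < 0, so one of the two terms of the functional equation agrees
    and the discrepancy halves. *)
Let psiE s : Psi s = F s.
Proof.
apply/eqP; rewrite -subr_eq0 -normr_le0; apply: half_pow_small => n.
have c1 := c_gt1; elim: n s => [|n IH] s.
  have := pr_ge0 sq [set p | sep s p.1 p.2]; rewrite -/(Psi s).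
  have : Psi s <= 1 by apply: pr_le1; exact: msep.
  have : 0 <= F s by exact: pr_ge0.
  have : F s <= 1 by apply: pr_le1.
  by rewrite expr0 invr1 ler_norml; lra.
have sE : s = a * (s / a) by rewrite mulrC divfK// gt_eqF.
rewrite sE psi_scale cantor_fun_scale; set u := s / a.
have := IH u; have := IH (u - c); rewrite exprS invfM !ler_norml.
have [u1|u1] := leP 1 u.
  by rewrite (psi_ge1 u1) (cantor_fun_ge1 u1); lra.
have uc : u - c < 0 by lra.
by rewrite (psi_lt0 uc) (cantor_fun_lt0 uc); lra.
Qed.

(** * Two-sided closeness and the oo-correlation integral *)

Let Cinf s := pr sq [set p | sep s p.1 p.2 /\ sep s p.2 p.1].

Let mCinf (g h g' h' : RR -> MR) s s' :
  measurable_fun setT g -> measurable_fun setT h ->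
  measurable_fun setT g' -> measurable_fun setT h' ->
  measurable [set p | sep s (g p) (h p) /\ sep s' (g' p) (h' p)].
Proof. by move=> mg mh mg' mh'; apply: measurableI; exact: msep. Qed.

(* For two points T0 x and T1 y, the orbit of x is compared with that of y at
   even times and with that of f y at odd times. *)
Let G s := pr sq [set p | sep s p.1 (f p.2) /\ sep s p.2 p.1].

Let G_swap s : pr sq [set p | sep s p.1 p.2 /\ sep s p.2 (f p.1)] = G s.
Proof.
apply: etrans (pr_square_swap mu (mCinf s s m1 mf2 m2 m1)); congr pr.
by apply/seteqP; split=> p /= [].
Qed.

Let cinf_scale s : Cinf (a * s) = 2^-1 * (Cinf s + G (s - c)).
Proof.
rewrite /Cinf (@sq_branch _ (fun b b' =>
  if b then (if b' then [set p | sep s p.1 p.2 /\ sep s p.2 p.1]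
    else [set p | sep (s - c) p.1 p.2 /\ sep (s - c) p.2 (f p.1)])
  else (if b' then [set p | sep (s - c) p.1 (f p.2) /\ sep (s - c) p.2 p.1]
    else [set p | sep s p.1 p.2 /\ sep s p.2 p.1]))).
- by rewrite G_swap -/(G _) -!/(Cinf _); lra.
- exact: mCinf.
- by move=> [] []; exact: mCinf.
- move=> [] [] x y ux uy /=.
  + by rewrite !sep_diag.
  + by rewrite sep10// sep01.
  + by rewrite sep01// sep10.
  + by rewrite !sep_diag.
Qed.

(* Of the two constraints defining G, the one that keeps its scale is either
   implied by the other (s >= c > 1) or the other one is almost surely false. *)
Let G_scale s : G (a * s) = F (s - c).
Proof.
have c1 := c_gt1; have uf x : unit x -> unit (f x) by exact: falpha_unit.
rewrite -psiE /G (@sq_branch _ (fun b b' =>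
  if b then (if b' then [set p | sep (s - c) p.1 (f p.2) /\ sep s p.2 p.1]
    else [set p | sep s p.1 p.2 /\ sep (s - c) p.2 (f p.1)])
  else (if b' then [set p | sep s p.1 (f p.2) /\ sep (s - c) p.2 p.1]
    else [set p | sep (s - c) p.1 (f p.2) /\ sep s p.2 p.1]))); first last.
- have f0 x : unit x -> f (br false x) = br true x by exact: falpha_branch0.
  have f1 x : unit x -> f (br true x) = br false (f x) by exact: falpha_branch1.
  move=> [] [] x y ux uy /=;
    rewrite ?(f0 _ ux) ?(f0 _ uy) ?(f1 _ uy) ?(f1 _ ux).
  + by rewrite sep10 ?sep_diag//; exact: uf.
  + by rewrite sep_diag// sep01.
  + by rewrite sep_diag ?sep10//; exact: uf.
  + by rewrite sep01// sep_diag.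
- by move=> [] []; exact: mCinf.
- exact: mCinf.
have [sc|sc] := leP c s.
  have s1 : 1 <= s by lra.
  rewrite (@sq_eq_on [set p | sep (s - c) p.1 (f p.2) /\ sep s p.2 p.1]
    [set p | sep (s - c) p.1 (f p.2)]); first last.
  - by move=> x y ux uy; split=> [[]//|h]; split=> //; exact: sep_ge1.
  - exact: msep.
  - exact: mCinf.
  rewrite (@sq_eq_on [set p | sep s p.1 (f p.2) /\ sep (s - c) p.2 p.1]
    [set p | sep (s - c) p.2 p.1]); first last.
  - by move=> x y ux uy; split=> [[]//|h]; split=> //; apply: sep_ge1 => //;
    exact: uf.
  - exact: msep.
  - exact: mCinf.
  rewrite (@sq_eq_on [set p | sep s p.1 p.2 /\ sep (s - c) p.2 (f p.1)]
    [set p | sep (s - c) p.2 (f p.1)]); first last.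
  - by move=> x y ux uy; split=> [[]//|h]; split=> //; exact: sep_ge1.
  - exact: msep.
  - exact: mCinf.
  by rewrite psi_f psi_swap psi_swap_f; lra.
have p0 : Psi (s - c) = 0 by apply: psi_lt0; lra.
have z (A B : set RR) : measurable A -> measurable B -> A `<=` B ->
    pr sq B = Psi (s - c) -> pr sq A = 0.
  move=> mA mB AB Bp; apply/eqP; rewrite eq_le pr_ge0 andbT -p0 -Bp.
  exact: pr_mono.
rewrite p0.
rewrite (z _ [set p | sep (s - c) p.1 (f p.2)])//; first last.
- by move=> p [].
- exact: msep.
- exact: mCinf.
rewrite (z _ [set p | sep (s - c) p.2 p.1])//; first last.
- by move=> p [].
- exact: msep.
- exact: mCinf.
rewrite (z _ [set p | sep (s - c) p.2 (f p.1)])//; first last.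
- by move=> p [].
- exact: msep.
- exact: mCinf.
lra.
Qed.

Let cinf_rec s : Cinf (a * s) = 2^-1 * (Cinf s + F ((s - c) / a - c)).
Proof.
by rewrite cinf_scale -G_scale [a * _]mulrC divfK// gt_eqF.
Qed.

Let cinf_ge1 s : 1 <= s -> Cinf s = 1.
Proof.
move=> s1; apply: sq_one; first exact: mCinf.
by move=> x y ux uy; split; exact: sep_ge1.
Qed.

(** * The distribution of the difference of two independent points *)

Definition diff_cdf t := pr sq [set p | p.1 - p.2 <= t].
Let Phi := diff_cdf.

Let mdiff : measurable_fun setT (fun p : RR => p.1 - p.2 : MR).
Proof. exact: measurable_funB. Qed.

Let mPhi (I : interval R) : measurable [set p : RR | p.1 - p.2 \in I].
Proof.
have mI : measurable ([set` I] : set MR) by exact: measurable_itv.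
by have := @mdiff measurableT _ mI; rewrite setTI.
Qed.

Let mle t : measurable [set p : RR | p.1 - p.2 <= t].
Proof. exact: mPhi `]-oo, t]. Qed.

Lemma diff_cdf_homo : {homo Phi : x y / x <= y}.
Proof. by move=> x y xy; apply: pr_mono => // p /= /le_trans; exact. Qed.

Lemma diff_cdf_ge1 (t : R) : 1 <= t -> Phi t = 1.
Proof. by move=> t1; apply: sq_one => // x y; rewrite /unit /=; lra. Qed.

Lemma diff_cdf_scale t : Phi (a * t) =
  4^-1 * Phi (t + c) + 2^-1 * Phi t + 4^-1 * Phi (t - c).
Proof.
rewrite /Phi /diff_cdf (@sq_branch _ (fun b b' =>
  [set p | p.1 - p.2 <= t + (b'%:R - b%:R) * c])) //=; last first.
  move=> b b' x y ux uy /=; rewrite /br /branch; move: (b%:R) (b'%:R) => k k'.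
  have e : a * (t + (k' - k) * c) = a * t + (k' - k) * (1 - a).
    by rewrite -ac; ring.
  by split=> h; [rewrite -(ler_pM2l a0)|rewrite -(ler_pM2l a0) in h]; lra.
rewrite !subrr subr0 sub0r mul0r mulN1r addr0 mul1r; lra.
Qed.

Lemma diff_set1 t : pr sq [set p | p.1 - p.2 = t] = 0.
Proof.
apply/eqP; rewrite eq_le pr_ge0 andbT; apply: pr_square_le.
  have mt : measurable ([set t] : set MR) by exact: measurable_set1.
  by have := @mdiff measurableT _ mt; rewrite setTI.
move=> x; rewrite (_ : xsection _ x = [set x - t]) ?(pr_set1 a0 a2 mu_a)//.
apply/seteqP; split=> y; rewrite /xsection /= inE /=.
  by move=> <-; rewrite subKr.
by move=> ->; rewrite subKr.
Qed.

Lemma pr_diff_lt t : pr sq [set p | p.1 - p.2 < t] = Phi t.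
Proof.
have ml : measurable [set p : RR | p.1 - p.2 < t].
  exact: mPhi `]-oo, t[.
have me : measurable [set p : RR | p.1 - p.2 = t].
  have mt : measurable ([set t] : set MR) by exact: measurable_set1.
  by have := @mdiff measurableT _ mt; rewrite setTI.
rewrite -[LHS]addr0 -(diff_set1 t) -prU//.
  congr pr; apply/seteqP; split=> p /=; first by move=> [/ltW//|->].
  by rewrite le_eqVlt => /orP[/eqP|]; [right|left].
by apply/seteqP; split=> p //= [/[swap]->]; rewrite ltxx.
Qed.

(** Exchange of the coordinates, together with the absence of atoms, which identifies strict and
    weak inequalities. *)
Lemma diff_cdfN t : Phi (- t) = 1 - Phi t.
Proof.
rewrite -(pr_diff_lt t) -prC; last first.
  exact: mPhi `]-oo, t[.
apply: etrans (esym (pr_square_swap mu (mle (- t)))) _; congr pr; apply/seteqP;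
  split=> p /=.
  by move=> h h'; lra.
by move/negP; rewrite -leNgt; lra.
Qed.

(** For fixed x the admissible y fill an interval of length l, whose mass is at most F l by
    subadditivity of [F]; Fubini concludes. *)
Lemma diff_cdf_incr (t l : R) : 0 <= l -> Phi (t + l) - Phi t <= F l.
Proof.
move=> l0; have m := mPhi `]t, t + l].
have -> : Phi (t + l) - Phi t = pr sq [set p | p.1 - p.2 \in `]t, t + l]].
  apply/eqP; rewrite subr_eq [eqbRHS]addrC -prU//.
    apply/eqP; congr pr; apply/seteqP; split=> p /=.
      by move=> h; have [?|h'] := leP (p.1 - p.2) t; [left|right;
        rewrite /= in_itv /= h' h].
    by move=> [h|]; [rewrite (le_trans h)// lerDl|rewrite in_itv /= => /andP[]].
  apply/seteqP; split=> p //=; rewrite in_itv /= => -[h /andP[h' _]].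
  by move: h; rewrite leNgt h'.
apply: pr_square_le => // x.
set u := x - (t + l).
have mI : measurable (`]u, u + l]%classic : set MR) by exact: measurable_itv.
have m1u : measurable ([set u] : set MR) by exact: measurable_set1.
(* The section is closed at u and open at u + l; the null point u is split off to reach an increment
   of [F]. *)
apply: (@le_trans _ _ (pr mu ([set u] `|` `]u, u + l]%classic))).
  apply: pr_mono; [exact: measurable_xsection|exact: measurableU|].
  move=> y; rewrite /xsection /= inE /= in_itv /= => /andP[h1 h2].
  have [->|yu] := eqVneq y u; [by left|right].
  by rewrite in_itv /= lt_neqAle eq_sym yu /= /u; lra.
rewrite prU//; last first.
  by apply/seteqP; split=> y //= [->]; rewrite in_itv /= ltxx.
rewrite (pr_set1 a0 a2 mu_a) add0r.
suff -> : pr mu (`]u, u + l]%classic : set MR) = F (u + l) - F u.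
  exact: (cantor_subadd a0 a2 ac cantor_fun_homo cantor_fun_lt0 cantor_fun_ge1
    cantor_fun_scale).
apply/eqP; rewrite eq_sym subr_eq [eqbRHS]addrC -prU//.
  apply/eqP; congr pr; apply/seteqP; split=> y; rewrite /= !in_itv /=.
    by move=> h; have [?|h'] := leP y u; [left|right; rewrite ?in_itv;
      apply/andP].
  by move=> [h|/andP[//]]; rewrite (le_trans h)// lerDl.
apply/seteqP; split=> y //=; rewrite !in_itv /= => -[h /andP[h' _]].
by move: h; rewrite leNgt h'.
Qed.

Lemma cantor_fun_le_diff_cdf t : F t <= Phi t.
Proof.
have -> : F t = pr sq (`]-oo, t]%classic `*` setT).
  by rewrite pr_square_rect// prT mulr1.
apply: sq_le_on => //; first exact: measurableX.
by move=> x y; rewrite /unit /= in_itv /= => ux uy [h _]; lra.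
Qed.

(** Without atoms, the mass of [-r, r] is [Phi r - Phi (- r)]; symmetry does the rest. *)
Lemma corr_one_eq r : 0 <= r ->
  fine (corr_integral mu f (Some 1%N) r) = 2 * Phi r - 1.
Proof.
move=> r0.
have sup1 (x y : MR) : (varrho f (Some 1%N) x y <= r%:E)%E = (`|x - y| <= r).
  rewrite /varrho (_ : [set _ | _ in _] = [set `|x - y|%:E]).
    by rewrite ereal_sup1 lee_fin.
  apply/seteqP; split=> z /=; first by move=> [[|i]] // _ <-.
  by move=> ->; exists 0%N.
have mC := mPhi `[- r, r].
have -> : corr_integral mu f (Some 1%N) r =
    sq ([set p : RR | p.1 - p.2 \in `[- r, r]] `&`
        ((`[0, 1]%classic : set MR) `*` (`[0, 1]%classic : set MR))).
  congr (sq _); apply/seteqP; split=> p /=; rewrite sup1 !in_itv /= -ler_norml.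
    by move=> [].
  by move=> [? []].
rewrite -/(pr sq _) pr_ae//; first last.
- by rewrite pr_square_rect// mu01 mulr1.
- exact: measurableX.
have ml : measurable [set p : RR | p.1 - p.2 < - r].
  exact: mPhi `]-oo, (- r)[.
have : Phi r = pr sq [set p | p.1 - p.2 < - r] +
    pr sq [set p | p.1 - p.2 \in `[- r, r]].
  rewrite -prU//.
    congr pr; apply/seteqP; split=> p /=.
      by move=> h; have [?|h'] := ltP (p.1 - p.2) (- r); [left|right;
        rewrite /= in_itv /= h' h].
    by move=> [h|/andP[]//]; lra.
  apply/seteqP; split=> p //=; rewrite in_itv /= => -[h /andP[h' _]].
  by move: h; rewrite ltNge h'.
by rewrite pr_diff_lt diff_cdfN; lra.
Qed.

Let corr_inf_eq r : fine (corr_integral mu f None r) = Cinf r.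
Proof.
have sup1 (x y : MR) : (varrho f None x y <= r%:E)%E <-> sep r x y /\ sep r y x.
  split.
    move=> h.
    have hi i : `|iter i f x - iter i f y| <= r.
      by rewrite -lee_fin (le_trans _ h)//; apply: ereal_sup_ubound; exists i.
    by split=> i; have := hi i; rewrite ler_norml; lra.
  move=> [h1 h2]; apply: ge_ereal_sup => _ [i _ <-].
  by rewrite lee_fin ler_norml; have := h1 i; have := h2 i; lra.
have mC := mCinf r r m1 m2 m2 m1.
have -> : corr_integral mu f None r =
    sq ([set p : RR | sep r p.1 p.2 /\ sep r p.2 p.1] `&`
        ((`[0, 1]%classic : set MR) `*` (`[0, 1]%classic : set MR))).
  congr (sq _); apply/seteqP; split=> p /=.
    by move=> [? ? /sup1].
  by move=> [/sup1 ? []].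
rewrite -/(pr sq _) pr_ae//; first exact: measurableX.
by rewrite pr_square_rect// mu01 mulr1.
Qed.

Lemma corr_inf_scale s : fine (corr_integral mu f None (a * s)) =
  2^-1 * (fine (corr_integral mu f None s) + F ((s - c) / a - c)).
Proof. by rewrite !corr_inf_eq cinf_rec. Qed.

Lemma corr_inf_ge1 s : 1 <= s -> fine (corr_integral mu f None s) = 1.
Proof. by rewrite corr_inf_eq; exact: cinf_ge1. Qed.

End Correlation.

(** * Infinite determinism *)

Section RightLimits.
Variable R : realType.

Lemma at_right0P (V : set R) :
  0^'+ V <-> exists2 e : R, 0 < e & forall x, 0 < x < e -> V x.
Proof.
split=> [[e /= e0 eV]|[e e0 eV]].
  exists e => // x /andP[x0 xe]; apply: eV => //=.
  by rewrite sub0r normrN gtr0_norm.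
exists e => //= x; rewrite /ball_ /= sub0r normrN => xe x0; apply: eV.
by rewrite x0 -(gtr0_norm x0).
Qed.

Lemma le_limf_einf_right (g : R -> R) (e m : R) : 0 < e ->
  (forall x, 0 < x < e -> m <= g x) ->
  (m%:E <= limf_einf (fun x => (g x)%:E) 0^'+)%E.
Proof.
move=> e0 h; rewrite limf_einfE; apply: le_ereal_sup_tmp.
exists (ereal_inf ((fun x => (g x)%:E) @` [set x | 0 < x < e])).
  by exists [set x | 0 < x < e] => //; apply/at_right0P; exists e.
by apply: le_ereal_inf_tmp => _ [x hx <-]; rewrite lee_fin h.
Qed.

Lemma limf_einf_right_le (g : R -> R) (u : nat -> R) (m : R) :
  (forall n, 0 < u n) -> (forall e : R, 0 < e -> exists n, u n < e) ->
  (forall n, g (u n) <= m) ->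
  (limf_einf (fun x => (g x)%:E) 0^'+ <= m%:E)%E.
Proof.
move=> u0 ue h; rewrite limf_einfE; apply: ge_ereal_sup => _ [V FV <-].
have [e e0 eV] := (at_right0P V).1 FV; have [n une] := ue _ e0.
apply: (@le_trans _ _ (g (u n))%:E); last by rewrite lee_fin.
by apply: ereal_inf_lbound; exists (u n) => //; apply: eV; rewrite u0.
Qed.

Lemma limf_esup_right_le (g : R -> R) (e m : R) : 0 < e ->
  (forall x, 0 < x < e -> g x <= m) ->
  (limf_esup (fun x => (g x)%:E) 0^'+ <= m%:E)%E.
Proof.
move=> e0 h; have := @le_limf_einf_right (fun x => - g x) e (- m) e0.
rewrite (_ : (fun x => (- g x)%:E) = (\- (fun x => (g x)%:E))%E)//.
rewrite limf_einfN EFinN leeN2; apply=> x hx; rewrite lerN2; exact: h.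
Qed.

Lemma le_limf_esup_right (g : R -> R) (u : nat -> R) (m : R) :
  (forall n, 0 < u n) -> (forall e : R, 0 < e -> exists n, u n < e) ->
  (forall n, m <= g (u n)) ->
  (m%:E <= limf_esup (fun x => (g x)%:E) 0^'+)%E.
Proof.
move=> u0 ue h; have := @limf_einf_right_le (fun x => - g x) u (- m) u0 ue.
rewrite (_ : (fun x => (- g x)%:E) = (\- (fun x => (g x)%:E))%E)//.
rewrite limf_einfN EFinN leeN2; apply=> n; rewrite lerN2; exact: h.
Qed.

End RightLimits.

(** * Transfer of the quotient bounds to the determinism of [falpha] *)

Section DeterminismBounds.
Variables (R : realType) (a : R).
Hypotheses (a0 : 0 < a) (a2 : a < 2^-1).
Variable mu : probability (measurableTypeR R) R.
Hypothesis mu_a : is_mu_alpha a mu.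

Let c := (1 - a) / a.
Let ac : a * c = 1 - a.
Proof. by rewrite /c mulrC divfK// gt_eqF. Qed.

Let det := det_infty mu (falpha a).
Let F := cantor_fun mu.
Let Phi := diff_cdf mu.
Let L r := fine (corr_integral mu (falpha a) None r).
Let rho := 1 - a ^+ 2.

Let detE r : 0 <= r -> det r = L r / (2 * Phi r - 1).
Proof. by move=> r0; rewrite /det /det_infty (corr_one_eq a0 a2 mu_a). Qed.

Let Fm : {homo F : x y / x <= y} := @cantor_fun_homo R mu.
Let F0 := cantor_fun_lt0 mu_a.
Let F1 := cantor_fun_ge1 mu_a.
Let FE : forall x, F (a * x) = 2^-1 * (F x + F (x - c)) :=
  cantor_fun_scale a0 a2 mu_a.
Let Pm : {homo Phi : x y / x <= y} := @diff_cdf_homo R mu.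
Let P1 := diff_cdf_ge1 mu_a.
Let PN := diff_cdfN a0 a2 mu_a.
Let PE : forall x, Phi (a * x) =
  4^-1 * Phi (x + c) + 2^-1 * Phi x + 4^-1 * Phi (x - c) :=
  diff_cdf_scale a0 a2 mu_a.
Let PF := diff_cdf_incr a0 a2 mu_a.
Let FP := cantor_fun_le_diff_cdf mu_a.
Let L1 := corr_inf_ge1 a0 a2 mu_a.
Let LE : forall x, L (a * x) = 2^-1 * (L x + F ((x - c) / a - c)) :=
  corr_inf_scale a0 a2 mu_a.

Let pos n (x : R) : a <= x -> 0 <= a ^+ n * x.
Proof.
by move=> ax; rewrite mulr_ge0 ?exprn_ge0 ?(ltW a0)// (le_trans _ ax)// ltW.
Qed.

Let a_rho : a <= rho. Proof. exact: a_le_rho. Qed.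

Lemma det_infty_min n (x : R) : a <= x <= 1 -> x != rho ->
  det (a ^+ n * rho) < det (a ^+ n * x).
Proof.
move=> /[dup] ax /andP[ax1 _] xr; rewrite !detE ?pos//.
exact: (det_min a0 a2 ac Fm F0 F1 FE Pm P1 PN PE PF L1 LE).
Qed.

Lemma det_infty_ge_rho n (x : R) : a <= x <= 1 ->
  det (a ^+ n * rho) <= det (a ^+ n * x).
Proof.
move=> ax; have [->//|xr] := eqVneq x rho.
exact/ltW/det_infty_min.
Qed.

Lemma det_infty_le1 n (x : R) : a <= x <= 1 -> det (a ^+ n * x) <= 1.
Proof.
move=> /[dup] ax /andP[ax1 _]; rewrite detE ?pos//.
exact: (det_le1 a0 a2 ac F0 Pm P1 PN PE FP L1 LE).
Qed.

Lemma det_infty_rho_ge n : 3^-1 <= det (a ^+ n * rho).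
Proof.
rewrite detE ?pos//.
exact: (det_rho_ge a0 a2 ac F0 FE Pm P1 PN PE L1 LE).
Qed.

Lemma det_infty_rho_le n : det (a ^+ n * rho) <= 8 / 15.
Proof.
rewrite detE ?pos//.
exact: (det_rho_le a0 a2 ac F0 FE Pm P1 PN PE L1 LE).
Qed.

Lemma det_infty_rho0 : det rho = 8 / 15.
Proof.
rewrite detE; last by rewrite (le_trans _ a_rho)// ltW.
exact: (det_rho0 a0 a2 ac F0 FE P1 PN PE L1 LE).
Qed.

Lemma det_infty_pow n : a <= 3^-1 -> det (a ^+ n) = 1.
Proof.
move=> a3; rewrite detE; last by rewrite exprn_ge0// ltW.
exact: (det_pow_small a0 a2 ac F0 P1 PN PE L1 LE).
Qed.

Lemma det_infty_rho_small n : a <= 3^-1 -> det (a ^+ n * rho) = 8 / 15.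
Proof.
move=> a3; rewrite detE ?pos//.
exact: (det_rho_small a0 a2 ac F0 FE P1 PN PE L1 LE).
Qed.

Lemma det_infty_large : 3^-1 < a -> exists2 d : R, d < 1 &
  forall n x, a <= x <= 1 -> det (a ^+ n.+1 * x) <= d.
Proof.
move=> a3; have [d d1 hd] :=
  det_bound_large a0 a2 ac Fm F0 F1 Pm P1 PN PE FP L1 LE a3.
exists d => // n x /[dup] ax /andP[ax1 _]; rewrite detE ?pos//; exact: hd.
Qed.

End DeterminismBounds.

Theorem theorem28 (R : realType) (a : R) (a_gt0 : 0 < a) (a_lt2 : a < 2^-1)
    (mu : probability (measurableTypeR R) R) (mu_a : is_mu_alpha a mu) :
  let det := det_infty mu (falpha a) in
  [/\ (* (1) *)
      forall h : nat,
        local_min_on `]0, 1]%classic det (a ^+ h - a ^+ h.+2) /\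
        (forall r : R, r \in `[a ^+ h.+1, a ^+ h] -> r != a ^+ h - a ^+ h.+2 ->
           det (a ^+ h - a ^+ h.+2) < det r),
      (* (2) *)
      ((3^-1)%:E <= det_liminf mu (falpha a) <= (8 / 15)%:E)%E,
      (* (3) *)
      (a <= 3^-1 -> det_limsup mu (falpha a) = 1%E) /\
      (3^-1 < a -> (det_limsup mu (falpha a) < 1)%E)
    & (* (4) *)
      a <= 3^-1 ->
        [/\ forall r : R, r \in `]0, 1] -> 8 / 15 <= det r <= 1,
            exists2 r : R, r \in `]0, 1] & det r = 8 / 15
          & forall h : nat, det (a ^+ h) = 1]].
Proof.
move=> det.
have aS n : a ^+ n - a ^+ n.+2 = a ^+ n * (1 - a ^+ 2).
  by rewrite mulrBr mulr1 -exprD addn2.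
have a1 : a < 1 by move: a_lt2; lra.
have ar := a_le_rho a_gt0 a_lt2; have r1 := rho_lt1 a_gt0.
have small (e : R) : 0 < e -> exists n, a ^+ n < e by exact: exp_small.
have an0 n : 0 < a ^+ n by rewrite exprn_gt0.
have an1 n : a ^+ n <= 1 by rewrite exprn_ile1 ?(ltW a_gt0) ?(ltW a1).
have rn0 n : 0 < a ^+ n * (1 - a ^+ 2).
  by rewrite mulr_gt0// (lt_le_trans a_gt0 ar).
have rnsmall (e : R) : 0 < e -> exists n, a ^+ n * (1 - a ^+ 2) < e.
  move=> /small[n ne]; exists n; apply: le_lt_trans ne.
  by rewrite ger_pMr// ltW.
have scale n (r : R) : r \in `[a ^+ n.+1, a ^+ n] ->
    exists2 x, a <= x <= 1 & r = a ^+ n * x.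
  rewrite in_itv /= => /andP[h1 h2]; exists (r / a ^+ n).
    by rewrite ler_pdivlMr// -exprS h1 ler_pdivrMr// mul1r.
  by rewrite mulrC divfK// gt_eqF.
have minP n r : r \in `[a ^+ n.+1, a ^+ n] -> r != a ^+ n - a ^+ n.+2 ->
    det (a ^+ n - a ^+ n.+2) < det r.
  move=> /scale[x ax ->]; rewrite aS => xr; apply: det_infty_min => //.
  by apply: contra_neq xr => ->.
split.
- move=> h; split; last exact: minP.
  split.
    rewrite aS /= in_itv /= rn0 (le_trans _ (an1 h))//.
    by rewrite ger_pMr// ltW.
  (* The point is interior to [a^(h+1), a^h], so minimality on that interval is local minimality. *)
  have : a ^+ h - a ^+ h.+2 \in `]a ^+ h.+1, a ^+ h[.
    rewrite aS in_itv /= exprSr ltr_pM2l// gtr_pMr// r1 andbT.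
    rewrite expr2; have : a * a < a * 2^-1 by rewrite ltr_pM2l.
    by move: a_lt2; lra.
  move=> /near_in_itvoo; apply: filterS => s sI _.
  have [<-//|sr] := eqVneq (a ^+ h - a ^+ h.+2) s.
  by apply/ltW/minP; [exact: subset_itv_oo_cc|rewrite eq_sym].
- apply/andP; split.
    (* Every radius below 1 is compared with the minimum of its own scale interval. *)
    apply: (@le_limf_einf_right _ _ 1) => // r /andP[r0 /ltW rle].
    have [|n [x ax ->]] := unit_scale a_gt0 a_lt2 (r := r); first by rewrite r0.
    apply: le_trans (det_infty_ge_rho a_gt0 a_lt2 mu_a n ax).
    exact: det_infty_rho_ge.
  apply: (limf_einf_right_le rn0 rnsmall) => n.
  exact: det_infty_rho_le.
- split=> a3.
    apply/eqP; rewrite eq_le; apply/andP; split.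
      apply: (@limf_esup_right_le _ _ 1) => // r /andP[r0 /ltW rle].
      have [|n [x ax ->]] := unit_scale a_gt0 a_lt2 (r := r);
        first by rewrite r0.
      exact: det_infty_le1.
    apply: (le_limf_esup_right an0 small) => n.
    by rewrite det_infty_pow.
  have [d d1 hd] := det_infty_large a_gt0 a_lt2 mu_a a3.
  apply: (@le_lt_trans _ _ d%:E); last by rewrite lte_fin.
  (* The uniform bound requires a factor a, so radii below a are taken and r / a is scaled. *)
  apply: (limf_esup_right_le a_gt0) => r /andP[r0 /ltW ra].
  have [|n [x ax]] := unit_scale a_gt0 a_lt2 (r := r / a).
    by rewrite divr_gt0//= ler_pdivrMr// mul1r.
  move=> /(congr1 ( *%R a)); rewrite mulrC divfK ?gt_eqF// => ->.
  by rewrite mulrA -exprS hd.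
- move=> a3; split.
  + move=> r; rewrite in_itv /= => r01.
    have [n [x ax ->]] := unit_scale a_gt0 a_lt2 r01.
    rewrite det_infty_le1// andbT -(det_infty_rho_small a_gt0 a_lt2 mu_a n a3).
    exact: det_infty_ge_rho.
  + exists (1 - a ^+ 2); last exact: det_infty_rho0.
    by rewrite in_itv /= (lt_le_trans a_gt0 ar) ltW.
  + by move=> h; exact: det_infty_pow.
Qed.
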